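(* Let $N\ge 2$ and let $X=(X_1,\dots,X_N)$ be an N-BBM (killing from the left) started from $X_1(0)=\dots=X_N(0)=0$. Fix $\mu$ with $0\le \mu< v_N$, and for $R>0$ let $$\tau_{R,\mu}:=\inf\{t>0:\ X_1(t)-\mu t\ge R\}.$$ Then there are constants $\alpha,\beta$ depending on $\mu$ (and $N$) but not on $R$ such that $\mathbb{E}[\tau_{R,\mu}]<\alpha+\beta R$ for all $R>0$.
   Context: Brunet–Derrida system in $\mathbb{R}$ with $N\ge2$ particles, score function $s:\mathbb{R}\to\mathbb{R}$ and drift $\mu\in\mathbb{R}$: let $(J_i)_{i\ge0}$ ($J_0=0$) be the jump times of a Poisson process of rate $N$, $(K_i)_{i\ge1}$ i.i.d. uniform on $\{1,\dots,N\}$, and independent standard Brownian motions, all mutually independent. Between jump times each particle moves as an independent Brownian motion with drift $\mu$ (i.e. $B(t)+\mu t$). At each time $J_i$, the particle with minimal score $s(Y_n(J_i^-))$ (ties broken arbitrarily) is removed and replaced by a copy of the particle $Y_{K_i}(J_i^-)$ (equivalently, the minimal-score particle jumps to the position $Y_{K_i}(J_i^-)$; if it is that same particle nothing happens). At all times particles are relabelled so that $Y_1(t)\le\dots\le Y_N(t)$. An N-BBM (killing from the left) is the case $s(x)=x$, $\mu=0$. It is a known fact (cited in the paper) that for an N-BBM, for any initial condition, $X_1(t)/t\to v_N$ and $(X_N(t)-X_1(t))/t\to0$ almost surely as $t\to\infty$, where $v_N>0$ is a deterministic constant depending only on $N$; $v_N$ is called the asymptotic speed of the N-BBM. *)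

(* Defs.v *)
From HB Require Import structures.
From mathcomp Require Import all_boot all_order all_algebra.
From mathcomp Require Import all_classical all_reals all_analysis.
Import Order.TTheory GRing.Theory Num.Theory.
Import numFieldNormedType.Exports.

Set Implicit Arguments.
Unset Strict Implicit.
Unset Printing Implicit Defensive.

Local Open Scope classical_set_scope.
Local Open Scope ring_scope.

(* J_k = E_0 + ... + E_{k-1}: jump times of the Poisson clock, J_0 = 0. *)
Definition jtimes {R : realType} (E : nat -> R) (k : nat) : R :=
  \sum_(j < k) E j.

Definition seqmin {R : realType} (s : seq R) : R := head 0 (sort <=%R s).

Definition order_stat {R : realType} (s : seq R) (k : nat) : R :=
  nth 0 (sort <=%R s) k.

(* One selection step: the (first) particle of minimal position jumps to
   the position of the particle of rank k (0-based) in the ordered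
   configuration just before the jump. *)
Definition bbm_jump {R : realType} (pre : seq R) (k : nat) : seq R :=
  set_nth 0 pre (index (seqmin pre) pre) (order_stat pre k).

(* configuration just after the k-th jump (k = 0: initial config 0,...,0).
   Particle i moves with the increments of its own Brownian path B i. *)
Fixpoint bbm_state {R : realType} (N : nat) (B : nat -> R -> R)
    (E : nat -> R) (K : nat -> nat) (k : nat) : seq R :=
  match k with
  | 0 => nseq N 0
  | k'.+1 =>
      bbm_jump [seq nth 0 (bbm_state N B E K k') i
                    + (B i (jtimes E k) - B i (jtimes E k')) | i <- iota 0 N]
               (K k')
  end.

Lemma jtimes_ex_asbool {R : realType} (J : nat -> R) (t : R) :
  (exists k, t < J k) -> exists k, `[< t < J k >].
Proof. by case=> k hk; exists k; apply/asboolP. Qed.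

(* the index k such that J_k <= t < J_{k+1} (0 if no such k exists,
   which only happens on the null event of explosion). *)
Definition interval_index {R : realType} (J : nat -> R) (t : R) : nat :=
  match pselect (exists k, t < J k) with
  | left H => (ex_minn (jtimes_ex_asbool H)).-1
  | right _ => 0%N
  end.

Definition bbm_positions {R : realType} (N : nat) (B : nat -> R -> R)
    (E : nat -> R) (K : nat -> nat) (t : R) : seq R :=
  let k := interval_index (jtimes E) t in
  [seq nth 0 (bbm_state N B E K k) i + (B i t - B i (jtimes E k))
  | i <- iota 0 N].

Definition bbm_X1 {R : realType} (N : nat) (B : nat -> R -> R)
    (E : nat -> R) (K : nat -> nat) (t : R) : R :=
  seqmin (bbm_positions N B E K t).

Definition NBBM_X1 {R : realType} {d} {Omega : measurableType d} (N : nat)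
    (B : nat -> R -> Omega -> R) (E : nat -> Omega -> R)
    (K : nat -> Omega -> nat) (t : R) (w : Omega) : R :=
  bbm_X1 N (fun i s => B i s w) (fun k => E k w) (fun k => K k w) t.

Definition mutual_indep {R : realType} {d} {Omega : measurableType d}
    (P : probability Omega R) (Xs : seq (Omega -> R)) : Prop :=
  forall As : seq (set R), size As = size Xs ->
    (forall j, (j < size As)%N -> measurable (nth set0 As j)) ->
    P (\big[setI/setT]_(j < size Xs) (nth (fun=> 0) Xs j @^-1` nth set0 As j))
    = (\prod_(j < size Xs) P (nth (fun=> 0%R) Xs j @^-1` nth set0 As j))%E.

(* B_0,...,B_{N-1}: independent standard Brownian motions;
   E_0, E_1, ...: i.i.d. Exp(N) (inter-jump times of a rate-N Poisson process);
   K_0, K_1, ...: i.i.d. uniform on {0,...,N-1};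
   all mutually independent. *)
Definition NBBM_driver {R : realType} {d} {Omega : measurableType d}
    (P : probability Omega R) (N : nat) (B : nat -> R -> Omega -> R)
    (E : nat -> Omega -> R) (K : nat -> Omega -> nat) : Prop :=
  (
      (forall i, (i < N)%N -> forall w, B i 0 w = 0) /\
      (forall i, (i < N)%N -> forall w,
          {within `[0, +oo[%classic, continuous (fun t => B i t w)}) /\
      (forall i, (i < N)%N -> forall t, measurable_fun setT (B i t)) /\
      (forall i, (i < N)%N -> forall s t, 0 <= s -> s < t ->
          forall A, measurable A ->
          P ((fun w => B i t w - B i s w) @^-1` A)
          = normal_prob 0 (Num.sqrt (t - s)) A) /\
      (forall k, measurable_fun setT (E k)) /\
      (forall k A, measurable A -> P (E k @^-1` A) = exponential_prob N%:R A) /\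
      (forall k j, measurable [set w | K k w = j]) /\
      (forall k j, (j < N)%N -> P [set w | K k w = j] = (N%:R^-1)%:E) /\
      (* joint independence: for every time grid 0 = t_0 < t_1 < ... < t_n,
         the increments of all B_i on the grid together with
         E_0..E_{m-1}, K_0..K_{m-1} are mutually independent *)
      (forall ts : seq R, sorted <%R (0 :: ts) -> forall m,
         mutual_indep P
           (flatten [seq [seq (fun w => B i (nth 0 ts j) w - B i (nth 0 (0 :: ts) j) w)
                         | j <- iota 0 (size ts)] | i <- iota 0 N]
            ++ [seq E k | k <- iota 0 m]
            ++ [seq (fun w => (K k w)%:R) | k <- iota 0 m]))).

(* tau_{R,mu} = inf { t > 0 : X_1(t) - mu t >= R }  (inf of empty set = +oo) *)
Definition hitting_time {R : realType} {Omega : Type} (X1 : R -> Omega -> R)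
    (mu r : R) (w : Omega) : \bar R :=
  ereal_inf [set t%:E | t in [set t | 0 < t /\ r <= X1 t w - mu * t]].

(* Main.v *)
Require Import Defs.
From HB Require Import structures.
From mathcomp Require Import all_boot all_order all_algebra.
From mathcomp Require Import all_classical all_reals all_analysis.
From mathcomp Require Import measurable_realfun ring lra zify.
Import Order.TTheory GRing.Theory Num.Theory.
Import numFieldNormedType.Exports.
Local Open Scope classical_set_scope.
Local Open Scope ring_scope.

(** Sampled at the jump times, the process is a Markov chain driven by the rows
    (Brownian increments over one inter-jump period, length of the period,
    index of the duplicated particle).  The rows are i.i.d.: this is exact when
    the periods are rounded up to a grid, since the jump times are then
    deterministic on each grid cell, and it passes to the limit by path
    continuity.  The Brownian increments being exchangeable given the past, they
    may be attached to the ranks of the particles instead of their labels; the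
    sorted chain so obtained is monotone in its initial state, hence its minimum
    over [m] more jumps grows at least by an independent copy of the minimum of
    the chain started from 0.

    Since [X_1(t) / t] tends to [vN > mu] and the negative part of the growth
    over [m] jumps is dominated by a sum of [m] identically distributed
    integrable variables, for [m] large the expected growth of [X_1(t) - mu t]
    over a block of [m] jumps is positive, even after truncation from above.
    Wald's argument for the truncated walk bounds the expected number of blocks
    before [X_1(t) - mu t] exceeds [r] by an affine function of [r]; the blocks
    have a finite mean duration independent of their past. *)

(** * Cylinder sigma-algebras *)

(** The independence hypothesis speaks of increments over deterministic time grids, whereas a row
    uses increments between random times; this obstacle forces the rounding. Independence is
    expressed by product formulas for lower boxes, which determine joint laws and pass to pointwise
    limits. Ranked rows are not i.i.d. by definition, because the reordering is random; it is
    however decided by the earlier rows.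

    An almost sure speed does not by itself give a mean speed. Fix [v] strictly between [mu] and
    [vN]. Unless the minimum after [m] jumps lies below [v] times the elapsed time, the growth is at
    least [v - mu] times that time, whose mean is proportional to [m]. On the exceptional event, of
    arbitrarily small probability, the loss is at most a sum of [m] terms of one law, whose tails
    are therefore uniformly small. Both contributions are linear in [m], so that only slopes are
    compared. The truncation from above bounds by a constant [c] the amount by which the stopped
    walk passes the level [r], whence the factor [r + c]. *)

Section cylinder.
Context {R : realType}.
Implicit Types (p M : nat) (a : nat -> nat -> R).

(** Lower orthants are stable under intersection, so joint laws can be compared through their
    distribution functions. *)
Definition box {T : Type} p M (X : nat -> nat -> T -> R) a : set T :=
  [set w | forall k i, (k < M)%N -> (i < p)%N -> X k i w < a k i].

Definition coord (k i : nat) (u : nat -> nat -> R) : R := u k i.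

Definition cylgen p M : set (set (nat -> nat -> R)) :=
  [set box p M coord a | a in setT].

(** The carrier is the whole path space for all [p] and [M]; only the sigma-algebra varies. A
    function of paths can thus be declared measurable in finitely many rows without changing its
    domain. *)
Definition cyl p M : Type := g_sigma_algebraType (cylgen p M).
HB.instance Definition _ p M := Measurable.copy (cyl p M)
  (g_sigma_algebraType (cylgen p M)).

Lemma boxE {T : Type} p M (X : nat -> nat -> T -> R) a :
  box p M X a =
  \bigcap_(k in `I_M) \bigcap_(i in `I_p) (X k i @^-1` `]-oo, a k i[).
Proof.
apply/seteqP; split=> w /=.
  by move=> h k kM i ip /=; rewrite in_itv /=; exact: h.
by move=> h k i kM ip; have := h k kM i ip; rewrite /= in_itv.
Qed.

Lemma measurable_box {d} {T : measurableType d} p M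
    (X : nat -> nat -> T -> R) a :
  (forall k i, (k < M)%N -> (i < p)%N -> measurable_fun setT (X k i)) ->
  measurable (box p M X a).
Proof.
move=> mX; rewrite boxE; apply: bigcap_measurableType => k kM.
apply: bigcap_measurableType => i ip.
by rewrite -[X in measurable X]setTI; exact: mX.
Qed.

Lemma boxI {T : Type} p M (X : nat -> nat -> T -> R) a b :
  box p M X a `&` box p M X b =
  box p M X (fun k i => Order.min (a k i) (b k i)).
Proof.
apply/seteqP; split=> w /=.
  by move=> [ha hb] k i kM ip; rewrite lt_min ha// hb.
by move=> h; split=> k i kM ip; have := h _ _ kM ip; rewrite lt_min => /andP[].
Qed.

Lemma box_cover {T : Type} p M (X : nat -> nat -> T -> R) :
  \bigcup_n box p M X (fun _ _ => n%:R) = setT.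
Proof.
rewrite -subTset => w _.
exists (\sum_(k < M) \sum_(i < p) (Num.bound (X k i w)))%N => //= k i kM ip.
apply: le_lt_trans (ler_norm _) _.
apply: lt_le_trans (archi_boundP _) _ => //.
rewrite (le_trans (_ : _ <= (Num.bound (X k i w))%:R)) //.
  by rewrite /Num.bound normr_id.
rewrite ler_nat (bigD1 (Ordinal kM)) //= (bigD1 (Ordinal ip)) //=.
by rewrite -addnA leq_addr.
Qed.

Lemma box_cyl_measurable p M a : measurable (box p M coord a : set (cyl p M)).
Proof. by apply: sub_sigma_algebra; exists a. Qed.

Lemma measurable_coord p M k i : (k < M)%N -> (i < p)%N ->
  measurable_fun setT (coord k i : cyl p M -> R).
Proof.
move=> kM ip; apply: (measurability _ (RGenInftyO.measurableE R)) => //.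
move=> _ [_ [x ->] <-]; rewrite setTI.
(* A box bounds every coordinate, so the bounds of the other coordinates are sent to infinity. *)
have -> : coord k i @^-1` `]-oo, x[%classic =
  \bigcup_n (box p M coord (fun k' i' =>
     if (k' == k) && (i' == i) then x else n%:R) : set (cyl p M)).
  apply/seteqP; split=> u /=.
    rewrite in_itv /= => ux.
    have : (\bigcup_n box p M coord (fun _ _ => n%:R)) u by rewrite box_cover.
    move=> [n _ hn]; exists n => // k' i' kM' ip'.
    by case: ifPn => [/andP[/eqP -> /eqP ->]//|_]; exact: hn.
  by move=> [n _ /(_ k i kM ip)]; rewrite !eqxx in_itv.
by apply: bigcupT_measurable => n; exact: box_cyl_measurable.
Qed.

Lemma measurable_to_cyl {d} {T : measurableType d} p M
    (X : nat -> nat -> T -> R) :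
  (forall k i, (k < M)%N -> (i < p)%N -> measurable_fun setT (X k i)) ->
  measurable_fun setT (fun w => (fun k i => X k i w) : cyl p M).
Proof.
move=> mX; apply: (@measurability _ _ _ (cyl p M) setT _ (cylgen p M)) => //.
move=> _ [_ [a _ <-] <-]; rewrite setTI.
by rewrite (_ : _ @^-1` _ = box p M X a)//; exact: measurable_box.
Qed.

Lemma cyl_measure_unique p M (m1 m2 : {measure set (cyl p M) -> \bar R}) :
  (m1 setT < +oo)%E ->
  (forall a, m1 (box p M coord a) = m2 (box p M coord a)) ->
  forall A, measurable A -> m1 A = m2 A.
Proof.
move=> m1oo m12.
apply: (@g_sigma_algebra_measure_unique _ _ (cyl p M) (cylgen p M) _
  (fun n => box p M coord (fun _ _ => n%:R))).
- by move=> _ [a _ <-]; exact: box_cyl_measurable.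
- by move=> n; exists (fun _ _ => n%:R).
- exact: box_cover.
- move=> _ _ [a _ <-] [b _ <-]; rewrite boxI.
  by exists (fun k i => Order.min (a k i) (b k i)).
- by move=> _ [a _ <-].
- move=> n; apply: le_lt_trans m1oo; apply: le_measure; rewrite ?inE//.
  exact: box_cyl_measurable.
Qed.

(** Handles a random index, permutation or grid cell: with countably many values, measurability of
    each branch replaces joint measurability. *)
Lemma measurable_fun_countcase {d d'} {T : measurableType d}
    {Y : measurableType d'} {C : countType} (c : T -> C) (f : C -> T -> Y) :
  (forall x, measurable (c @^-1` [set x])) ->
  (forall x, measurable_fun setT (f x)) ->
  measurable_fun setT (fun w => f (c w) w).
Proof.
move=> mc mf _ B mB; rewrite setTI.
have -> : (fun w => f (c w) w) @^-1` B =
    \bigcup_(x : C) (c @^-1` [set x] `&` f x @^-1` B).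
  apply/seteqP; split=> w /=; first by exists (c w).
  by move=> [x _ [/= <-]].
apply: countable_bigcupT_measurable; first exact: countableP.
move=> x; apply: measurableI => //.
by rewrite -[X in measurable X]setTI; exact: mf.
Qed.

End cylinder.

(** * Transfer of integrals from box probabilities *)

Section transfer.
Context {R : realType} {d : measure_display} {T : measurableType d}.
Variable P : probability T R.
Local Open Scope ereal_scope.

Lemma ge0_integral_mrestr (A : set T) (mA : measurable A) (f : T -> \bar R) :
  measurable_fun setT f -> (forall w, 0 <= f w) ->
  \int[mrestr P mA]_w f w = \int[P]_(w in A) f w.
Proof.
move=> mf f0.
rewrite (@ge0_negligible_integral _ _ _ _ setT (~` A))//.
- rewrite setTD setCK.
  apply: eq_measure_integral => B mB BA.
  by rewrite /= /mrestr setIidl.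
- exact: measurableC.
- by rewrite /= /mrestr setICl measure0.
Qed.

(** When [c] is the probability of [A], the hypothesis on boxes says that [X] is independent of [A]
    and has the law of [Y]. The two finite measures on cylinders agree on boxes, hence
    everywhere. *)
Lemma cyl_transfer p M (X Y : nat -> nat -> T -> R) (A : set T) (c : {nonneg R})
    (g : (nat -> nat -> R) -> \bar R) :
  (forall k i, (k < M)%N -> (i < p)%N -> measurable_fun setT (X k i)) ->
  (forall k i, (k < M)%N -> (i < p)%N -> measurable_fun setT (Y k i)) ->
  measurable A ->
  (forall a, P (A `&` box p M X a) = c%:num%:E * P (box p M Y a)) ->
  measurable_fun setT (g : cyl p M -> \bar R) -> (forall u, 0 <= g u) ->
  \int[P]_(w in A) g (fun k i => X k i w) =
  c%:num%:E * \int[P]_w g (fun k i => Y k i w).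
Proof.
move=> mX mY mA XY mg g0.
have mX' := measurable_to_cyl _ _ _ mX.
have mY' := measurable_to_cyl _ _ _ mY.
rewrite -(ge0_integral_mrestr A mA (fun w => g (fun k i => X k i w)))//; last first.
  exact: (measurableT_comp mg mX').
pose m1_ : {measure set (cyl p M) -> \bar R} :=
  pushforward (mrestr P mA) (fun w => (fun k i => X k i w) : cyl p M).
pose m2_ : {measure set (cyl p M) -> \bar R} :=
  mscale c (pushforward P (fun w => (fun k i => Y k i w) : cyl p M)).
pose m1 := m1_ mX'; pose m2 := m2_ mY'.
transitivity (\int[m1]_u g u).
  by rewrite ge0_integral_pushforward.
transitivity (\int[m2]_u g u); last first.
  by rewrite ge0_integral_mscale// ge0_integral_pushforward.
apply: eq_measure_integral => B mB _.
apply: cyl_measure_unique => //.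
- rewrite /m1 /= /pushforward /mrestr preimage_setT setTI.
  by apply: le_lt_trans (probability_le1 _ _) _ => //; rewrite ltry.
- by move=> a; rewrite /m1 /m2 /= /mscale /pushforward /mrestr setIC -XY.
Qed.

End transfer.

(** * Label chains and rank chains *)

Section chains.
Context {R : realType}.
Implicit Types (s t x : seq R) (u : nat -> nat -> R) (v : nat -> R).

Lemma sort_perm_le s t : perm_eq s t -> sort <=%R s = sort <=%R t.
Proof. by move=> st; apply/(perm_sortP le_total le_trans le_anti). Qed.

Definition addv N s v : seq R := [seq nth 0 s i + v i | i <- iota 0 N].

(* Breaking ties by index makes the sorting permutation the only one for which
   the sequence is sorted, which gives its measurability. *)
Definition lexle s (i j : nat) : bool :=
  (nth 0 s i < nth 0 s j) || ((nth 0 s i == nth 0 s j) && (i <= j)%N).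

Definition sortperm N s : seq nat := sort (lexle s) (iota 0 N).

Lemma lexle_total s : total (lexle s).
Proof.
move=> i j; rewrite /lexle.
by case: (ltgtP (nth 0 s i) (nth 0 s j)) => //= _; exact: leq_total.
Qed.

Lemma lexle_trans s : transitive (lexle s).
Proof.
move=> j i k; rewrite /lexle => /orP[ij|/andP[/eqP -> ij]] /orP[jk|/andP[/eqP <- jk]].
- by rewrite (lt_trans ij jk).
- by rewrite ij.
- by rewrite jk.
- by rewrite eqxx (leq_trans ij jk) orbT.
Qed.

Lemma lexle_anti s : antisymmetric (lexle s).
Proof.
move=> i j; rewrite /lexle.
by case: ltgtP => //= _; rewrite -eqn_leq => /eqP.
Qed.

(** Uniqueness of the sorted arrangement turns the event that the permutation equals [l] into
    finitely many comparisons of coordinates. *)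
Lemma sortpermP N s l : (sortperm N s == l) =
  perm_eq (iota 0 N) l && sorted (lexle s) l.
Proof.
apply/eqP/andP => [<-|[p sl]].
  by rewrite perm_sym perm_sort perm_refl sort_sorted//; exact: lexle_total.
apply: (sorted_eq (@lexle_trans s) (@lexle_anti s)) => //.
  exact: sort_sorted (@lexle_total s) _.
by rewrite perm_sort.
Qed.

Lemma perm_sortperm N s : perm_eq (sortperm N s) (iota 0 N).
Proof. by rewrite perm_sort. Qed.

Lemma size_sortperm N s : size (sortperm N s) = N.
Proof. by rewrite size_sort size_iota. Qed.

Lemma map_sortperm N s : size s = N ->
  map (nth 0 s) (sortperm N s) = sort <=%R s.
Proof.
move=> sN; apply: (sorted_eq le_trans le_anti).
- have : sorted (lexle s) (sortperm N s) by apply: sort_sorted; exact: lexle_total.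
  rewrite sorted_map; apply: sub_sorted => i j.
  by rewrite /lexle /= => /orP[/ltW//|/andP[/eqP ->]].
- exact: sort_sorted le_total _.
- rewrite perm_sym perm_sort.
  have e : s = [seq nth 0 s i | i <- iota 0 N] by rewrite -sN [RHS]mkseq_nth.
  by rewrite [X in perm_eq X _]e perm_map// perm_sym perm_sortperm.
Qed.

(** The labelled jump chain as a function of the rows alone. The duplicated rank is stored as a real
    in column [N.+1], hence the truncation. *)
Fixpoint lchain N u k : seq R :=
  if k is k'.+1 then
    bbm_jump (addv N (lchain N u k') (u k')) (Num.truncn (u k' N.+1))
  else nseq N 0.

(** Entry [i] becomes the increment of the particle of current rank [i]. The permutation reads only
    the rows before [k], which is what makes exchangeability of row [k] applicable. *)
Definition rerank N u (k i : nat) : R :=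
  if (i < N)%N then u k (nth 0%N (sortperm N (lchain N u k)) i) else u k i.

Definition rstep N x v : seq R :=
  let y := sort <=%R (addv N x v) in
  sort <=%R (nth 0 y (Num.truncn (v N.+1)) :: behead y).

Fixpoint rchain N u x k : seq R :=
  if k is k'.+1 then rstep N (rchain N u x k') (u k') else x.

Lemma size_addv N s v : size (addv N s v) = N.
Proof. by rewrite size_map size_iota. Qed.

Lemma nth_addv N s v i : (i < N)%N -> nth 0 (addv N s v) i = nth 0 s i + v i.
Proof. by move=> iN; rewrite (nth_map 0%N) ?size_iota// nth_iota. Qed.

Lemma seqmin_in s : (0 < size s)%N -> seqmin s \in s.
Proof.
rewrite /seqmin -(size_sort <=%R s) -(mem_sort <=%R s).
by case: (sort _ s) => //= x l _; rewrite mem_head.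
Qed.

Lemma set_nth_index_perm s (m z : R) : m \in s ->
  perm_eq (set_nth 0 s (index m s) z) (z :: rem m s).
Proof.
elim: s => //= x s IH; rewrite inE eq_sym.
case: eqVneq => [->//|xm /= ms] /=.
rewrite -(perm_cons x) in IH.
apply: perm_trans (IH ms) _.
by rewrite -[x :: z :: _]/([:: x] ++ [:: z] ++ _) perm_catCA.
Qed.

Lemma sort_bbm_jump s k : (0 < size s)%N ->
  sort <=%R (bbm_jump s k) =
  sort <=%R (nth 0 (sort <=%R s) k :: behead (sort <=%R s)).
Proof.
move=> s0; apply: sort_perm_le; rewrite /bbm_jump /order_stat.
have ms := seqmin_in s s0.
apply: perm_trans (set_nth_index_perm _ _ _ ms) _; rewrite perm_cons.
rewrite -(perm_cons (seqmin s)).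
have := perm_to_rem ms; rewrite perm_sym => /perm_trans; apply.
rewrite -(perm_sort <=%R s) {ms} /seqmin.
have := size_sort <=%R s; move: s0; case: s => // z s _.
by case: (sort <=%R _).
Qed.

Lemma size_bbm_jump s k : (0 < size s)%N -> size (bbm_jump s k) = size s.
Proof.
by move=> s0; rewrite size_set_nth (maxn_idPr _)// index_mem seqmin_in.
Qed.

Lemma size_lchain N u k : (0 < N)%N -> size (lchain N u k) = N.
Proof.
move=> N0; elim: k => [|k IH] /=; first by rewrite size_nseq.
by rewrite size_bbm_jump size_addv.
Qed.

Lemma size_rstep N x v : (0 < N)%N -> size (rstep N x v) = N.
Proof.
by move=> N0; rewrite /rstep size_sort /= size_behead size_sort size_addv prednK.
Qed.

Lemma size_rchain N u x k : (0 < N)%N -> size x = N ->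
  size (rchain N u x k) = N.
Proof. by move=> N0 xN; case: k => [//|k] /=; rewrite size_rstep. Qed.

Lemma rchain_sorted N u x k : sorted <=%R x -> sorted <=%R (rchain N u x k).
Proof.
by move=> sx; case: k => [//|k] /=; exact: sort_sorted le_total _.
Qed.

(* Attaching the increments to ranks instead of labels turns the sorted
   label chain into a chain that is monotone in its initial state. *)
Lemma sort_lchain N u k : (0 < N)%N ->
  sort <=%R (lchain N u k) = rchain N (rerank N u) (nseq N 0) k.
Proof.
move=> N0; elim: k => [|k IH] /=.
  apply: (sorted_eq le_trans le_anti); first exact: sort_sorted le_total _.
    by elim: N {N0} => //= -[|n]//=; rewrite lexx.
  by rewrite perm_sort.
rewrite sort_bbm_jump ?size_addv// /rstep -IH.
have -> : sort <=%R (addv N (sort <=%R (lchain N u k)) (rerank N u k)) =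
          sort <=%R (addv N (lchain N u k) (u k)).
  apply: sort_perm_le.
  set L := lchain N u k; set q := sortperm N L.
  have -> : addv N (sort <=%R L) (rerank N u k) =
            [seq nth 0 L i + u k i | i <- q].
    apply: (@eq_from_nth _ 0); first by rewrite size_addv size_map size_sortperm.
    move=> i; rewrite size_addv => iN.
    rewrite nth_addv// (nth_map 0%N) ?size_sortperm//.
    rewrite -(map_sortperm N) ?size_lchain// (nth_map 0%N) ?size_sortperm//.
    by rewrite /rerank iN.
  by rewrite /addv perm_map// perm_sortperm.
by rewrite /rerank ltnNge leqnSn.
Qed.

(** The constant [c] merges monotonicity and translation equivariance of the chain into one
    relation. *)
Definition shift_le (c : R) s t : Prop := size s = size t /\
  forall i, (i < size s)%N -> nth 0 s i + c <= nth 0 t i.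

Lemma sorted_nth_le_count s (z : R) i : sorted <=%R s -> (i < size s)%N ->
  (nth 0 s i <= z) = (i < count (fun y : R => (y <= z)%R) s)%N.
Proof.
elim: s i => //= y s IH i ys.
have ss := path_sorted ys.
have sy : forall w, w \in s -> y <= w.
  by move=> w ws; move: ys; rewrite (path_sortedE le_trans) => /andP[/allP /(_ _ ws)].
have [yz|zy] := leP y z.
  by case: i => [|i] /= si; rewrite ?yz// add1n ltnS; exact: IH.
have c0 : count (fun y : R => (y <= z)%R) s = 0%N.
  apply/eqP; rewrite -leqn0 leqNgt -has_count; apply/hasPn => w ws /=.
  by rewrite -ltNge (lt_le_trans zy)// sy.
rewrite c0 add0n ltn0; case: i => [|i] /= si; first by rewrite leNgt zy.
by apply/negbTE; rewrite -ltNge (lt_le_trans zy)// sy// mem_nth.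
Qed.

(** Termwise domination gives domination of the counting functions, and these determine the order
    statistics. *)
Lemma shift_le_sort c s t : shift_le c s t ->
  shift_le c (sort <=%R s) (sort <=%R t).
Proof.
move=> [st h]; split; first by rewrite !size_sort.
move=> i; rewrite size_sort => is_; rewrite -lerBrDr.
rewrite sorted_nth_le_count ?size_sort//; last exact: sort_sorted le_total _.
have : nth 0 (sort <=%R t) i <= nth 0 (sort <=%R t) i by [].
rewrite [in X in X -> _]sorted_nth_le_count ?size_sort -?st//; last first.
  exact: sort_sorted le_total _.
rewrite !(permP (permEl (perm_sort _ _))).
move: (nth 0 (sort _ t) i) => z /leq_trans; apply.
elim: s t st h {is_} => [|y s IH] [|y' t]//= [st] h.
apply: leq_add; last by apply: IH => // j js; exact: (h j.+1).
have := h 0%N erefl; rewrite /= => yy.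
by case: (leP y' z) => //= y'z; rewrite lerBrDr (le_trans yy y'z).
Qed.

(** The rank has to be below [N]: otherwise both steps would insert the default value [0], and
    [0 + c <= 0] fails for positive [c]. *)
Lemma shift_le_rstep N c s t v : (0 < N)%N -> size s = N ->
  (Num.truncn (v N.+1) < N)%N -> shift_le c s t ->
  shift_le c (rstep N s v) (rstep N t v).
Proof.
move=> N0 sN kN [st h]; apply: shift_le_sort.
have [|sz hy] := @shift_le_sort c (addv N s v) (addv N t v).
  split; rewrite !size_addv// => i iN; rewrite !nth_addv//.
  by rewrite addrAC lerD2r h// sN.
move: sz hy; rewrite !size_sort !size_addv => _ hy.
split; first by rewrite /= !size_behead !size_sort !size_addv.
move=> [|i]; rewrite /= size_behead size_sort size_addv; first by move=> _; exact: hy.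
by rewrite !nth_behead => iN; apply: hy; move: iN; rewrite ltnS; lia.
Qed.

Lemma shift_le_rchain N c s t u k : (0 < N)%N -> size s = N ->
  (forall j, (Num.truncn (u j N.+1) < N)%N) -> shift_le c s t ->
  shift_le c (rchain N u s k) (rchain N u t k).
Proof.
move=> N0 sN uN h; elim: k => [//|k IH] /=.
by apply: shift_le_rstep => //; rewrite size_rchain.
Qed.

Lemma rchain_add N u x k l :
  rchain N u x (k + l) = rchain N (fun j => u (k + j)%N) (rchain N u x k) l.
Proof. by elim: l => [|l IH]; rewrite ?addn0// addnS /= IH. Qed.

Definition rmin N u k : R := nth 0 (rchain N u (nseq N 0) k) 0.

(** After [k] steps all particles are at or above the minimum, so the state dominates the zero state
    translated by that minimum. Monotonicity preserves this when both are run with the same later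
    rows. *)
Lemma rmin_add N u k l : (0 < N)%N ->
  (forall j, (Num.truncn (u j N.+1) < N)%N) ->
  rmin N u k + rmin N (fun j => u (k + j)%N) l <= rmin N u (k + l).
Proof.
move=> N0 uN; rewrite /rmin rchain_add.
set x := rchain N u (nseq N 0) k.
have xN : size x = N by rewrite size_rchain ?size_nseq.
have sx : sorted <=%R x.
  by apply: rchain_sorted; elim: (N) => //= -[|n]//=; rewrite lexx.
have : shift_le (nth 0 x 0) (nseq N 0) x.
  split; rewrite size_nseq// => i iN; rewrite nth_nseq iN add0r.
  by apply: sorted_leq_nth => //; [exact: le_trans|rewrite inE xN..].
move=> /(shift_le_rchain N _ _ _ (fun j => u (k + j)%N) l N0).
rewrite size_nseq => /(_ erefl (fun j => uN _)) [_ /(_ 0%N)].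
by rewrite size_rchain ?size_nseq// addrC; apply.
Qed.

(** Selection only copies existing positions, so one row lowers the minimum by at most the sum of
    its absolute increments. *)
Lemma rmin_lb N u k : (0 < N)%N ->
  (forall j, (Num.truncn (u j N.+1) < N)%N) ->
  - \sum_(j < k) \sum_(i < N) `|u j i| <= rmin N u k.
Proof.
move=> N0 uN.
suff : all (fun z => - \sum_(j < k) \sum_(i < N) `|u j i| <= z)
         (rchain N u (nseq N 0) k).
  move/all_nthP => /(_ 0 0%N); apply.
  by rewrite size_rchain ?size_nseq.
elim: k => [|k IH] /=; first by rewrite big_ord0 oppr0 all_nseq lexx orbT.
rewrite big_ord_recr /= opprD.
set b := - _ in IH *; set S := \sum_(i < N) _.
have hy : all (fun z => b - S <= z)
    (sort <=%R (addv N (rchain N u (nseq N 0) k) (u k))).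
  rewrite all_sort; apply/(all_nthP 0) => i; rewrite size_addv => iN.
  rewrite nth_addv//; apply: lerD.
    by move/(all_nthP 0) : IH; apply; rewrite size_rchain ?size_nseq.
  rewrite lerNl (le_trans (ler_norm _))// normrN.
  by rewrite /S (bigD1 (Ordinal iN))//= lerDl sumr_ge0.
rewrite all_sort /=; apply/andP; split.
  by move/(all_nthP 0) : hy; apply; rewrite size_sort size_addv.
by move: hy; case: (sort _ _) => //= ? ? /andP[].
Qed.

End chains.

(** * Measurability of the chains *)

Section chain_measurability.
Context {R : realType}.

Definition seq_measurable {d} {T : measurableType d} (s : T -> seq R) : Prop :=
  forall i, measurable_fun setT (fun w => nth 0 (s w) i).

Definition nat_measurable {d} {T : measurableType d} (c : T -> nat) : Prop :=
  forall j, measurable (c @^-1` [set j]).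

Lemma measurable_bool_set {d} {T : measurableType d} (f : T -> bool) :
  measurable_fun setT f -> measurable [set w | f w].
Proof.
move=> mf; have := mf measurableT [set true] I.
by rewrite setTI.
Qed.

Lemma nat_measurable_truncn {d} {T : measurableType d} (f : T -> R) :
  measurable_fun setT f -> nat_measurable (fun w => Num.truncn (f w)).
Proof.
move=> mf j.
(* [truncn] sends negative reals to [0], so the fibre of [0] has no lower bound. *)
have -> : (fun w => Num.truncn (f w)) @^-1` [set j] =
    [set w | f w < j.+1%:R] `&`
    (if j is j'.+1 then [set w | j'.+1%:R <= f w] else setT).
  apply/seteqP; split => w /=.
    move=> e; split; first by rewrite -truncn_le_nat e.
    by case: j e => // j e; rewrite /= -truncn_gt_nat e.
  case=> h1 h2; apply/eqP; rewrite eqn_leq truncn_le_nat h1 /=.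
  by case: j h2 {h1} => // j; rewrite /= -truncn_gt_nat.
apply: measurableI.
  by apply: measurable_bool_set; exact: measurable_fun_ltr.
by case: j => // j; apply: measurable_bool_set; exact: measurable_fun_ler.
Qed.

Section seqs.
Context {d : measure_display} {T : measurableType d}.
Implicit Types (s : T -> seq R) (c : T -> nat).

Lemma measurable_lexle s i j : seq_measurable s ->
  measurable [set w | lexle (s w) i j].
Proof.
move=> ms; apply: measurable_bool_set; apply: measurable_or.
  exact: measurable_fun_ltr.
apply: measurable_and; first exact: measurable_fun_eqr.
exact: measurable_cst.
Qed.

Lemma measurable_sortperm N s l : seq_measurable s ->
  measurable ((fun w => sortperm N (s w)) @^-1` [set l]).
Proof.
move=> ms.
have -> : (fun w => sortperm N (s w)) @^-1` [set l] =
    [set w | perm_eq (iota 0 N) l && sorted (lexle (s w)) l].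
  by apply/seteqP; split => w /=; rewrite -sortpermP => /eqP.
case: perm_eq => /=; last by rewrite (_ : mkset _ = set0)// -subset0.
case: l => [|i l] /=; first by rewrite (_ : mkset _ = setT)// -subTset.
elim: l i => [|j l IH] i /=; first by rewrite (_ : mkset _ = setT)// -subTset.
rewrite (_ : mkset _ = [set w | lexle (s w) i j] `&`
                       [set w | path (lexle (s w)) j l]).
  by apply: measurableI => //; exact: measurable_lexle.
by apply/seteqP; split => w /= /andP.
Qed.

Lemma measurable_nth_rand s c : seq_measurable s -> nat_measurable c ->
  measurable_fun setT (fun w => nth 0 (s w) (c w)).
Proof.
move=> ms mc.
by apply: (measurable_fun_countcase c (fun j w => nth 0 (s w) j)).
Qed.

Lemma seq_measurable_sort N s : (forall w, size (s w) = N) ->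
  seq_measurable s -> seq_measurable (fun w => sort <=%R (s w)).
Proof.
move=> sN ms i.
case: (ltnP i N) => iN; last first.
  rewrite (_ : (fun _ => _) = cst 0); first exact: measurable_cst.
  by apply/funext => w; rewrite nth_default// size_sort sN.
rewrite (_ : (fun _ => _) =
  (fun w => nth 0 (s w) (nth 0%N (sortperm N (s w)) i))).
  apply: (measurable_fun_countcase (fun w => sortperm N (s w))
    (fun l w => nth 0 (s w) (nth 0%N l i))) => // l.
  exact: measurable_sortperm.
apply/funext => w; rewrite -(map_sortperm N)// (nth_map 0%N)//.
by rewrite size_sortperm.
Qed.

Lemma seq_measurable_addv N s (v : nat -> T -> R) :
  seq_measurable s -> (forall i, (i < N)%N -> measurable_fun setT (v i)) ->
  seq_measurable (fun w => addv N (s w) (v ^~ w)).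
Proof.
move=> ms mv i.
case: (ltnP i N) => iN; last first.
  rewrite (_ : (fun _ => _) = cst 0); first exact: measurable_cst.
  by apply/funext => w; rewrite nth_default// size_addv.
rewrite (_ : (fun _ => _) = (fun w => nth 0 (s w) i + v i w)).
  by apply: measurable_funD => //; exact: mv.
by apply/funext => w; rewrite nth_addv.
Qed.

Lemma seq_measurable_rstep N s (v : nat -> T -> R) : (0 < N)%N ->
  seq_measurable s -> (forall i, (i < N.+2)%N -> measurable_fun setT (v i)) ->
  seq_measurable (fun w => rstep N (s w) (v ^~ w)).
Proof.
move=> N0 ms mv; rewrite /rstep.
have my : seq_measurable (fun w => sort <=%R (addv N (s w) (v ^~ w))).
  apply: (@seq_measurable_sort N) => [w|]; first by rewrite size_addv.
  by apply: seq_measurable_addv => // i iN; apply: mv; lia.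
apply: (@seq_measurable_sort N) => [w|[|i] /=].
- by rewrite /= size_behead size_sort size_addv prednK.
- by apply: measurable_nth_rand => //; apply: nat_measurable_truncn; exact: mv.
- by under eq_fun do rewrite nth_behead; exact: my.
Qed.

Lemma seq_measurable_bbm_jump N s c : (0 < N)%N -> (forall w, size (s w) = N) ->
  seq_measurable s -> nat_measurable c ->
  seq_measurable (fun w => bbm_jump (s w) (c w)).
Proof.
move=> N0 sN ms mc i; rewrite /bbm_jump /order_stat.
have msort := @seq_measurable_sort N _ sN ms.
have mmin : measurable_fun setT (fun w => seqmin (s w)).
  by rewrite /seqmin; under eq_fun do rewrite -nth0; exact: msort.
have midx : nat_measurable (fun w => index (seqmin (s w)) (s w)).
  move=> j.
  have -> : (fun w => index (seqmin (s w)) (s w)) @^-1` [set j] =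
      [set w | nth 0 (s w) j == seqmin (s w)] `&`
      ([set w | (j < N)%N] `&`
      \bigcap_(l in `I_j) [set w | nth 0 (s w) l != seqmin (s w)]).
    apply/seteqP; split => w /=.
      have mn : seqmin (s w) \in s w by rewrite seqmin_in ?sN.
      move=> <-; rewrite nth_index// eqxx -(sN w) index_mem mn.
      by split => //; split => // l /= /(before_find 0) /= ->.
    move=> [/eqP e [jN h]]; apply/eqP; rewrite eqn_leq; apply/andP; split.
      by rewrite -e index_nth// sN.
    rewrite leqNgt; apply/negP => /h /=.
    by rewrite nth_index ?eqxx// seqmin_in// sN.
  apply: measurableI; first by apply: measurable_bool_set; exact: measurable_fun_eqr.
  apply: measurableI; first by apply: measurable_bool_set; exact: measurable_cst.
  apply: bigcap_measurableType => l _; apply: measurable_bool_set.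
  by apply: measurable_neg; exact: measurable_fun_eqr.
under eq_fun do rewrite nth_set_nth.
apply: (measurable_fun_countcase (fun w => index (seqmin (s w)) (s w))
  (fun j w => [eta nth 0 (s w) with j |-> nth 0 (sort <=%R (s w)) (c w)] i)) => // j.
by rewrite /=; case: eqP => // _; exact: measurable_nth_rand.
Qed.

End seqs.

Lemma seq_measurable_rchain N M k : (0 < N)%N -> (k <= M)%N ->
  seq_measurable (fun u : cyl N.+2 M => rchain N u (nseq N 0) k).
Proof.
move=> N0; elim: k => [|k IH] kM /=; first by move=> i; exact: measurable_cst.
apply: (@seq_measurable_rstep _ _ N _ (fun i (u : cyl N.+2 M) => coord k i u)) => //.
  by apply: IH; exact: ltnW.
by move=> i iN; exact: measurable_coord.
Qed.

Lemma seq_measurable_lchain N M k : (0 < N)%N -> (k <= M)%N ->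
  seq_measurable (fun u : cyl N.+2 M => lchain N u k).
Proof.
move=> N0; elim: k => [|k IH] kM /=; first by move=> i; exact: measurable_cst.
apply: (@seq_measurable_bbm_jump _ _ N) => //.
- by move=> w; rewrite size_addv.
- apply: (@seq_measurable_addv _ _ N _ (fun i (u : cyl N.+2 M) => coord k i u)).
    by apply: IH; exact: ltnW.
  by move=> i iN; apply: measurable_coord => //; lia.
- by apply: nat_measurable_truncn; exact: (@measurable_coord _ N.+2 M k N.+1).
Qed.

Lemma measurable_rerank N M k i : (0 < N)%N -> (k < M)%N -> (i < N.+2)%N ->
  measurable_fun setT (fun u : @cyl R N.+2 M => rerank N u k i).
Proof.
move=> N0 kM iN; rewrite /rerank.
case: (ltnP i N) => iN'; last exact: measurable_coord.
(* The added guard never fails for a permutation of [iota 0 N]; for an arbitrary list [l] it keeps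
   each branch inside the measurable columns. *)
rewrite (_ : (fun _ => _) = (fun u : cyl N.+2 M =>
  let j := nth 0%N (sortperm N (lchain N u k)) i in
  if (j < N)%N then u k j else 0)).
  apply: (measurable_fun_countcase
    (fun u : cyl N.+2 M => sortperm N (lchain N u k))
    (fun l (u : cyl N.+2 M) =>
      if (nth 0%N l i < N)%N then u k (nth 0%N l i) else 0)) => l.
    by apply: measurable_sortperm; apply: seq_measurable_lchain => //; exact: ltnW.
  case: (ltnP (nth 0%N l i) N) => lN; last exact: measurable_cst.
  by apply: measurable_coord => //; lia.
apply/funext => u /=; rewrite ifT//.
have : nth 0%N (sortperm N (lchain N u k)) i \in iota 0 N.
  by rewrite -(perm_mem (perm_sortperm N (lchain N u k))) mem_nth// size_sortperm.
by rewrite mem_iota add0n.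
Qed.

End chain_measurability.

(** * Limits of box probabilities *)

Section box_limit.
Context {R : realType} {d : measure_display} {T : measurableType d}.
Variable P : probability T R.

Definition pr (A : set T) : R := fine (P A).

Lemma pr_ge0 A : 0 <= pr A.
Proof. by rewrite /pr fine_ge0. Qed.

Lemma prE A : measurable A -> (pr A)%:E = P A.
Proof. by move=> mA; rewrite /pr fineK// fin_num_measure. Qed.

Lemma le_pr A B : measurable A -> measurable B -> A `<=` B -> pr A <= pr B.
Proof.
move=> mA mB AB; rewrite -lee_fin !prE//.
by apply: le_measure; rewrite ?inE.
Qed.

Lemma cvg_pr_nondecreasing (F : (set T)^nat) :
  (forall n, measurable (F n)) -> nondecreasing_seq F ->
  pr (F n) @[n --> \oo] --> pr (\bigcup_n F n).
Proof.
move=> mF ndF; apply: fine_cvg.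
rewrite prE; last exact: bigcupT_measurable.
by apply: nondecreasing_cvg_mu => //; exact: bigcupT_measurable.
Qed.

Lemma cvg_pr_nonincreasing (F : (set T)^nat) :
  (forall n, measurable (F n)) -> nonincreasing_seq F ->
  pr (F n) @[n --> \oo] --> pr (\bigcap_n F n).
Proof.
move=> mF ndF; apply: fine_cvg.
rewrite prE; last exact: bigcapT_measurable.
apply: nonincreasing_cvg_mu => //; last exact: bigcapT_measurable.
by apply: le_lt_trans (probability_le1 _ _) _ => //; rewrite ltry.
Qed.

Lemma cvg_prod_ord m (f : nat -> nat -> R) (l : nat -> R) :
  (forall j, (j < m)%N -> f j n @[n --> \oo] --> l j) ->
  \prod_(j < m) f j n @[n --> \oo] --> \prod_(j < m) l j.
Proof.
elim: m => [|m IH] h.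
  by under eq_fun do rewrite big_ord0; rewrite big_ord0; exact: cvg_cst.
under eq_fun do rewrite big_ord_recr /=.
rewrite big_ord_recr /=; apply: cvgM; last exact: h.
by apply: IH => j jm; apply: h; exact: ltnW.
Qed.

Lemma eventually_finite {I : choiceType} (D : set I) (Q : I -> nat -> Prop) :
  finite_set D ->
  (forall i, D i -> exists m, forall n, (m <= n)%N -> Q i n) ->
  exists m, forall n, (m <= n)%N -> forall i, D i -> Q i n.
Proof.
move=> /finite_seqP[s ->]; elim: s => [|x s IH] h.
  by exists 0%N => n _ i /=; rewrite in_nil.
have [m1 h1] := h x (mem_head _ _).
have [i is_|m2 h2] := IH; first by apply: h; rewrite /= inE is_ orbT.
exists (maxn m1 m2) => n; rewrite geq_max => /andP[n1 n2] i /=.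
by rewrite inE => /orP[/eqP ->|]; [exact: h1|exact: h2].
Qed.

Section limit.
Context {I : countType}.
Implicit Types (D : set I) (X : I -> T -> R) (a : I -> R).

(** An arbitrary index set [D] covers both a whole block of rows and a single row, the two sides of
    a product formula. *)
Definition gbox D X a : set T := [set w | forall i, D i -> X i w < a i].
Definition gboxle D X a : set T := [set w | forall i, D i -> X i w <= a i].

Lemma measurable_gbox D X a : (forall i, D i -> measurable_fun setT (X i)) ->
  measurable (gbox D X a).
Proof.
move=> mX; rewrite (_ : gbox _ _ _ =
    ~` \bigcup_i [set w | D i /\ a i <= X i w]); last first.
  apply/seteqP; split => w /= h.
    by move=> [i _ [/= Di]]; rewrite leNgt h.
  by move=> i Di; rewrite ltNge; apply/negP => aX; apply: h; exists i.
apply: measurableC; apply: countable_bigcupT_measurable => [|i].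
  exact: countableP.
have [Di|nDi] := pselect (D i); last first.
  by rewrite (_ : mkset _ = set0)// -subset0 => w [].
rewrite (_ : mkset _ = [set w | a i <= X i w]).
  rewrite (_ : mkset _ = setT `&` X i @^-1` `[a i, +oo[%classic); first exact: mX.
  by rewrite setTI; apply/seteqP; split => w /=; rewrite in_itv /= andbT.
by apply/seteqP; split => w /= => [[]|].
Qed.

Lemma measurable_gboxle D X a : (forall i, D i -> measurable_fun setT (X i)) ->
  measurable (gboxle D X a).
Proof.
move=> mX; rewrite (_ : gboxle _ _ _ =
    \bigcap_n gbox D X (fun i => a i + n.+1%:R^-1)); last first.
  apply/seteqP; split => w /= h.
    by move=> n _ i Di; rewrite (le_lt_trans (h i Di))// ltrDl invr_gt0.
  move=> i Di; apply/ler_addgt0Pr => e e0.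
  have [n ne] := @ltr_add_invr R 0 e e0.
  have /= /ltW /le_trans := h n Logic.I i Di; apply.
  by rewrite lerD2l; move: ne; rewrite add0r => /ltW.
by apply: bigcapT_measurable => n; exact: measurable_gbox.
Qed.

Variables (m1 m2 : nat) (D1 D2 : nat -> set I) (X Y : I -> T -> R).
Variables (Xn Yn : nat -> I -> T -> R).
Hypotheses (fD1 : forall j, (j < m1)%N -> finite_set (D1 j))
  (fD2 : forall j, (j < m2)%N -> finite_set (D2 j)).
Hypotheses (mX : forall j i, (j < m1)%N -> D1 j i -> measurable_fun setT (X i))
  (mY : forall j i, (j < m2)%N -> D2 j i -> measurable_fun setT (Y i))
  (mXn : forall n j i, (j < m1)%N -> D1 j i -> measurable_fun setT (Xn n i))
  (mYn : forall n j i, (j < m2)%N -> D2 j i -> measurable_fun setT (Yn n i)).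
Hypotheses
  (cX : forall j i w, (j < m1)%N -> D1 j i -> Xn n i w @[n --> \oo] --> X i w)
  (cY : forall j i w, (j < m2)%N -> D2 j i -> Yn n i w @[n --> \oo] --> Y i w).

(** A strict bound on the limit holds eventually along the sequence, so the box of [X] lies in the
    increasing union of the [U j m]. Bounds holding infinitely often survive in the limit only as
    weak ones, which is why the right-hand side has closed boxes. *)
Lemma gbox_limit_le_closed :
  (forall n a, \prod_(j < m1) pr (gbox (D1 j) (Xn n) a) <=
               \prod_(j < m2) pr (gbox (D2 j) (Yn n) a)) ->
  forall a, \prod_(j < m1) pr (gbox (D1 j) X a) <=
            \prod_(j < m2) pr (gboxle (D2 j) Y a).
Proof.
move=> XY a.
pose U j m := \bigcap_(n in [set n | (m <= n)%N]) gbox (D1 j) (Xn n) a.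
pose W j m := \bigcup_(n in [set n | (m <= n)%N]) gbox (D2 j) (Yn n) a.
have mU j m : (j < m1)%N -> measurable (U j m).
  move=> jm; apply: bigcap_measurableType => n _.
  by apply: measurable_gbox => i; exact: mXn.
have mW j m : (j < m2)%N -> measurable (W j m).
  move=> jm; apply: bigcup_measurable => n _.
  by apply: measurable_gbox => i; exact: mYn.
have ndU j : nondecreasing_seq (U j).
  move=> m n mn; apply/subsetPset => w h k /= nk.
  by apply: h => /=; exact: leq_trans nk.
have niW j : nonincreasing_seq (W j).
  move=> m n mn; apply/subsetPset => w [k /= nk h].
  by exists k => //=; exact: leq_trans nk.
have cU : \prod_(j < m1) pr (U j n) @[n --> \oo] -->
          \prod_(j < m1) pr (\bigcup_n U j n).
  apply: (cvg_prod_ord m1 (fun j n => pr (U j n))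
    (fun j => pr (\bigcup_n U j n))) => j jm.
  by apply: cvg_pr_nondecreasing => // n; exact: mU.
have cW : \prod_(j < m2) pr (W j n) @[n --> \oo] -->
          \prod_(j < m2) pr (\bigcap_n W j n).
  apply: (cvg_prod_ord m2 (fun j n => pr (W j n))
    (fun j => pr (\bigcap_n W j n))) => j jm.
  by apply: cvg_pr_nonincreasing => // n; exact: mW.
have UW : \prod_(j < m1) pr (\bigcup_n U j n) <= \prod_(j < m2) pr (\bigcap_n W j n).
  apply: (ler_cvg_to cU cW); apply: nearW => n.
  apply: le_trans (le_trans (XY n a) _).
    apply: ler_prod => j _; rewrite pr_ge0 /=; apply: le_pr.
    - exact: mU.
    - by apply: measurable_gbox => i; exact: mXn.
    - by move=> w /(_ n); apply => /=.
  apply: ler_prod => j _; rewrite pr_ge0 /=; apply: le_pr.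
  - by apply: measurable_gbox => i; exact: mYn.
  - exact: mW.
  - by move=> w h; exists n => /=.
apply: le_trans (le_trans UW _).
  apply: ler_prod => j _; rewrite pr_ge0 /=; apply: le_pr.
  - by apply: measurable_gbox => i; exact: mX.
  - by apply: bigcupT_measurable => n; exact: mU.
  move=> w h.
  have [m hm] : exists m, forall n, (m <= n)%N ->
      forall i, D1 j i -> Xn n i w < a i.
    apply: eventually_finite; first exact: fD1.
    move=> i Di.
    have /cvgr_lt /(_ (a i) (h i Di)) [m _ hm] := cX _ _ w (ltn_ord j) Di.
    by exists m => n /hm.
  by exists m => // n /= mn i Di; exact: hm.
apply: ler_prod => j _; rewrite pr_ge0 /=; apply: le_pr.
- by apply: bigcapT_measurable => n; exact: mW.
- by apply: measurable_gboxle => i; exact: mY.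
move=> w h i Di; rewrite leNgt; apply/negP => aY.
have /cvgr_gt /(_ (a i) aY) [m _ hm] := cY _ _ w (ltn_ord j) Di.
have [n /= mn hn] := h m Logic.I.
by have := lt_trans (hm n mn) (hn i Di); rewrite ltxx.
Qed.

(** Lowering the bounds by [l.+1%:R^-1] puts the closed box inside the open one; continuity from
    below then lets [l] tend to infinity. No continuity of the laws is required. *)
Lemma gbox_limit_le :
  (forall n a, \prod_(j < m1) pr (gbox (D1 j) (Xn n) a) <=
               \prod_(j < m2) pr (gbox (D2 j) (Yn n) a)) ->
  forall a, \prod_(j < m1) pr (gbox (D1 j) X a) <=
            \prod_(j < m2) pr (gbox (D2 j) Y a).
Proof.
move=> XY a.
pose b l i := a i - l.+1%:R^-1 : R.
have mb j l : (j < m1)%N -> measurable (gbox (D1 j) X (b l)).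
  by move=> jm; apply: measurable_gbox => i; exact: mX.
have c1 : \prod_(j < m1) pr (gbox (D1 j) X (b l)) @[l --> \oo] -->
          \prod_(j < m1) pr (\bigcup_l gbox (D1 j) X (b l)).
  apply: (cvg_prod_ord m1 (fun j l => pr (gbox (D1 j) X (b l)))
    (fun j => pr (\bigcup_l gbox (D1 j) X (b l)))) => j jm.
  apply: cvg_pr_nondecreasing => [n|]; first exact: mb.
  move=> m n mn; apply/subsetPset => w h i Di.
  apply: (lt_le_trans (h i Di)).
  by rewrite lerD2l lerN2 lef_pV2 ?posrE// ler_nat.
apply: (@le_trans _ _ (\prod_(j < m1) pr (\bigcup_l gbox (D1 j) X (b l)))).
  apply: ler_prod => j _; rewrite pr_ge0 /=; apply: le_pr.
  - by apply: measurable_gbox => i; exact: mX.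
  - by apply: bigcupT_measurable => n; exact: mb.
  move=> w h.
  have [m hm] : exists m, forall n, (m <= n)%N ->
      forall i, D1 j i -> X i w < b n i.
    apply: eventually_finite; first exact: fD1.
    move=> i Di; have [m ma] := ltr_add_invr (h i Di).
    exists m => n mn; rewrite ltrBrDr; apply: le_lt_trans ma.
    by rewrite lerD2l lef_pV2 ?posrE// ler_nat.
  by exists m => // i; exact: hm.
apply: (ler_cvg_to c1 (cvg_cst (\prod_(j < m2) pr (gbox (D2 j) Y a)))).
apply: nearW => l; apply: le_trans (gbox_limit_le_closed XY (b l)) _.
apply: ler_prod => j _; rewrite pr_ge0 /=; apply: le_pr.
- by apply: measurable_gboxle => i; exact: mY.
- by apply: measurable_gbox => i; exact: mY.
- move=> w h i Di; apply: (le_lt_trans (h i Di)).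
  by rewrite ltrBlDr ltrDl invr_gt0.
Qed.

End limit.

End box_limit.

(** * The driving noise on a time grid *)

Lemma mem_iota0 n i : (i \in iota 0 n) = (i < n)%N.
Proof. by rewrite mem_iota leq0n add0n. Qed.

Section driver_grid.
Context {R : realType} {d : measure_display} {Omega : measurableType d}.
Variable P : probability Omega R.
Local Notation pr := (pr P).

(** Pairing each variable with its event lets the products be split along concatenations of
    lists. *)
Lemma mutual_indep_pairs (z : seq ((Omega -> R) * {A : set R | measurable A})) :
  mutual_indep P (map fst z) ->
  P (\big[setI/setT]_(x <- z) (x.1 @^-1` sval x.2)) =
  (\prod_(x <- z) P (x.1 @^-1` sval x.2))%E.
Proof.
pose x0 : (Omega -> R) * {A : set R | measurable A} :=
  (fun=> 0, exist _ set0 measurable0).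
move=> /(_ [seq sval x.2 | x <- z]); rewrite !size_map => /(_ erefl).
have H : forall j, (j < size z)%N ->
    measurable (nth set0 [seq sval x.2 | x <- z] j).
  by move=> j jz; rewrite (nth_map x0)//; exact: (proj2_sig (nth x0 z j).2).
move=> /(_ H) h; rewrite !(big_nth x0) !big_mkord; transitivity (P
  (\big[setI/[set: Omega]]_(j < size z) (nth (fun=> 0) [seq i.1 | i <- z] j @^-1`
        nth set0 [seq sval x.2 | x <- z] j))).
  by congr (P _); apply: eq_bigr => j _; rewrite !(nth_map x0).
by rewrite h; apply: eq_bigr => j _; rewrite !(nth_map x0).
Qed.

Variables (N : nat) (B : nat -> R -> Omega -> R) (E : nat -> Omega -> R).
Variable K : nat -> Omega -> nat.
Hypotheses (hN : (0 < N)%N) (Hdrv : NBBM_driver P N B E K).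

Lemma measurable_drvB i t : (i < N)%N -> measurable_fun setT (B i t).
Proof. by case: Hdrv => _ [_ [h _]] iN; exact: h. Qed.

Lemma measurable_drvE k : measurable_fun setT (E k).
Proof. by case: Hdrv => _ [_ [_ [_ [h _]]]]; exact: h. Qed.

Lemma law_drvE k A : measurable A -> P (E k @^-1` A) = exponential_prob N%:R A.
Proof. by case: Hdrv => _ [_ [_ [_ [_ [h _]]]]]; exact: h. Qed.

Lemma measurable_drvK k j : measurable [set w | K k w = j].
Proof. by case: Hdrv => _ [_ [_ [_ [_ [_ [h _]]]]]]; exact: h. Qed.

Let mK k j : measurable [set w | K k w = j] := measurable_drvK k j.
Let mE k : measurable_fun setT (E k) := measurable_drvE k.

Lemma K_tail k : P [set w | (N <= K k w)%N] = 0.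
Proof.
have -> : [set w | (N <= K k w)%N] = ~` \bigcup_(j in `I_N) [set w | K k w = j].
  apply/seteqP; split => w /=.
    by move=> NK [j /= jN e]; move: NK; rewrite e leqNgt jN.
  by move=> h; rewrite leqNgt; apply/negP => KN; apply: h; exists (K k w).
rewrite probability_setC; last by apply: bigcup_measurable => j _.
have -> : P (\bigcup_(j in `I_N) [set w | K k w = j]) = 1%E.
  rewrite bigcup_mkord measure_bigsetU_ord//; last first.
    apply/trivIsetP => i j _ _ ij; rewrite -subset0 => w [/= -> e].
    by move/ord_inj : e ij => ->; rewrite eqxx.
  rewrite (eq_bigr (fun=> (N%:R^-1 : R)%:E)); last first.
    by move=> j _; case: Hdrv => _ [_ [_ [_ [_ [_ [_ [h _]]]]]]]; exact: h.
  rewrite sumEFin sumr_const card_ord -[_ *+ _]mulr_natl divff//.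
  by rewrite pnatr_eq0 -lt0n.
by rewrite subee.
Qed.

Lemma K_law k A : P ((fun w => (K k w)%:R : R) @^-1` A) =
                  P ((fun w => (K 0 w)%:R : R) @^-1` A).
Proof.
have e k' : (fun w => (K k' w)%:R : R) @^-1` A =
    \bigcup_(j in [set j | A j%:R]) [set w | K k' w = j].
  apply/seteqP; split => w /=; first by exists (K k' w).
  by move=> [j /= Aj ->].
have t k' : trivIset [set j | A j%:R] (fun j => [set w | K k' w = j]).
  apply/trivIsetP => i j _ _ ij; rewrite -subset0 => w [/= -> e'].
  by rewrite e' eqxx in ij.
rewrite !e !measure_bigcup//; apply: eq_eseriesr => j _ /=.
case: (ltnP j N) => jN.
  by case: Hdrv => _ [_ [_ [_ [_ [_ [_ [h _]]]]]]]; rewrite !h.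
have h k' : P [set w | K k' w = j] = 0%E.
  apply/eqP; rewrite eq_le measure_ge0 andbT -(K_tail k').
  apply: le_measure; rewrite ?inE//; last by move=> w /= ->.
  rewrite (_ : mkset _ = \bigcup_(j in [set j | (N <= j)%N]) [set w | K k' w = j]).
    exact: bigcup_measurable.
  apply/seteqP; split => w /=; first by exists (K k' w).
  by move=> [i /= Ni ->].
by rewrite !h.
Qed.

Lemma measurable_drvKR k : measurable_fun setT (fun w => (K k w)%:R : R).
Proof.
apply: (measurable_fun_countcase (K k) (fun j _ => j%:R : R)) => j.
  exact: measurable_drvK.
exact: measurable_cst.
Qed.

(* The upper end of the grid cell is used, so that grid times are positive. *)
Definition gridpt (n q : nat) : R := q.+1%:R / n.+1%:R.
Definition gridq n k w : nat := Num.truncn (n.+1%:R * E k w).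
Definition gridJ n k w : R := \sum_(j < k) gridpt n (gridq n j w).
(* A row lists the [N] Brownian increments (columns [i < N]), the inter-jump
   time (column [N]) and the duplicated rank (column [N.+1]). *)
Definition driver_of (J : nat -> Omega -> R) (k i : nat) (w : Omega) : R :=
  if (i < N)%N then B i (J k.+1 w) w - B i (J k w) w
  else if i == N then E k w else (K k w)%:R.

Lemma gridpt_gt0 n q : 0 < gridpt n q.
Proof. by rewrite divr_gt0. Qed.

Lemma nat_measurable_gridq n k : nat_measurable (gridq n k).
Proof. by apply: nat_measurable_truncn; exact: measurable_funM. Qed.

(** The rounded periods take countably many values, so measurability of [B] at fixed times is
    enough. *)
Lemma measurable_gridB n k i : (i < N)%N ->
  measurable_fun setT (fun w => B i (gridJ n k w) w).
Proof.
move=> iN.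
rewrite (_ : (fun _ => _) = (fun w => B i
    (\sum_(q <- [seq gridq n j w | j <- iota 0 k]) gridpt n q) w)).
  apply: (measurable_fun_countcase
    (fun w => [seq gridq n j w | j <- iota 0 k])
    (fun l w => B i (\sum_(q <- l) gridpt n q) w)) => [l|l]; last exact: measurable_drvB.
  have [lk|lk] := eqVneq (size l) k; last first.
    rewrite (_ : _ @^-1` _ = set0)// -subset0 => w /= e.
    by move: lk; rewrite -e size_map size_iota eqxx.
  rewrite (_ : _ @^-1` _ = \bigcap_(j in `I_k) [set w | gridq n j w = nth 0%N l j]).
    by apply: bigcap_measurableType => j _; exact: nat_measurable_gridq.
  apply/seteqP; split => w /=.
    by move=> <- j /= jk; rewrite (nth_map 0%N) ?size_iota// nth_iota.
  move=> h; apply: (@eq_from_nth _ 0%N); first by rewrite size_map size_iota.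
  move=> j; rewrite size_map size_iota => jk.
  by rewrite (nth_map 0%N) ?size_iota// nth_iota// add0n; exact: h.
apply/funext => w; congr (B i _ w).
by rewrite big_map -{2}(subn0 k) -/(index_iota 0 k) big_mkord.
Qed.

Lemma measurable_driver_of J k i :
  (forall l j, (j < N)%N -> measurable_fun setT (fun w => B j (J l w) w)) ->
  measurable_fun setT (driver_of J k i).
Proof.
move=> mJ; rewrite /driver_of; case: (ltnP i N) => iN.
  by apply: measurable_funB; exact: mJ.
by case: eqP => _; [exact: measurable_drvE|exact: measurable_drvKR].
Qed.

Definition mset_itv (c : R) : {A : set R | measurable A} :=
  exist _ `]-oo, c[%classic (measurable_itv _).

(** The bound on the period and its grid cell are merged into one set, since independence allows one
    event per variable. *)
Definition gridset n q (c : R) : set R :=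
  `]-oo, c[%classic `&` (fun x => Num.truncn (n.+1%:R * x)) @^-1` [set q].

Lemma measurable_gridset n q c : measurable (gridset n q c).
Proof.
apply: measurableI => //.
by apply: (@nat_measurable_truncn _ _ (measurableTypeR R)); exact: measurable_funM.
Qed.

(** The contribution of a row whose period lies in cell [q]. It does not depend on the position of
    the row, whence identical distribution. *)
Definition cellprob n q (b : nat -> R) : R :=
  (\prod_(i < N) fine (normal_prob 0 (Num.sqrt (gridpt n q)) `]-oo, b i[%classic)) *
  (pr (E 0 @^-1` gridset n q (b N)) *
   pr ((fun w => (K 0 w)%:R : R) @^-1` `]-oo, b N.+1[%classic)).

Lemma cellprob_ge0 n q b : 0 <= cellprob n q b.
Proof.
by rewrite mulr_ge0 ?mulr_ge0 ?pr_ge0// prodr_ge0// => i _; exact: fine_ge0.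
Qed.

Definition gridcell n M (q : nat -> nat) : set Omega :=
  [set w | forall k, (k < M)%N -> gridq n k w = q k].

Lemma measurable_gridcell n M q : measurable (gridcell n M q).
Proof.
rewrite (_ : gridcell _ _ _ = \bigcap_(k in `I_M) [set w | gridq n k w = q k]).
  by apply: bigcap_measurableType => j _; exact: nat_measurable_gridq.
by apply/seteqP; split => w h k; exact: h.
Qed.

Lemma gridcell_prob n M q a :
  P (box N.+2 M (driver_of (gridJ n)) a `&` gridcell n M q) =
  (\prod_(k < M) cellprob n (q k) (a k))%:E.
Proof.
have nSN : (N.+1 < N)%N = false by rewrite ltnNge leqnSn.
have nSE : (N.+1 == N) = false by rewrite gtn_eqF.
pose T k : R := \sum_(j < k) gridpt n (q j).
pose ts := [seq T k.+1 | k <- iota 0 M].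
have sts : size ts = M by rewrite size_map size_iota.
have TS k : T k.+1 - T k = gridpt n (q k).
  by rewrite /T big_ord_recr /= addrAC subrr add0r.
have T0 k : 0 <= T k by apply: sumr_ge0 => j _; exact/ltW/gridpt_gt0.
have ets : 0 :: ts = [seq T k | k <- iota 0 M.+1].
  rewrite /= {1}/T big_ord0; congr cons.
  by rewrite /ts (iotaDl 1 0) -map_comp.
have Tlt : {homo T : i j / (i < j)%N >-> i < j}.
  apply: homo_ltn => [y x z|k]; first exact: lt_trans.
  by rewrite -subr_gt0 TS gridpt_gt0.
have ntsS j : (j < M)%N -> nth 0 ts j = T j.+1.
  by move=> jM; rewrite (nth_map 0%N) ?size_iota// nth_iota.
have nts j : (j < M)%N -> nth 0 (0 :: ts) j = T j.
  by move=> jM; rewrite ets (nth_map 0%N) ?size_iota ?nth_iota// ltnW.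
have sorted_ts : sorted <%R (0 :: ts).
  by rewrite ets; apply: (homo_sorted Tlt); exact: iota_ltn_sorted.
have := Hdrv; move=> [_ [_ [_ [lawB [_ [_ [_ [_ indep]]]]]]]].
pose inc i j w := B i (nth 0 ts j) w - B i (nth 0 (0 :: ts) j) w.
(* The order is that of the independence hypothesis: increments particle by particle, then periods,
   then ranks. *)
pose z : seq ((Omega -> R) * {A : set R | measurable A}) :=
  [seq (inc i j, mset_itv (a j i)) | i <- iota 0 N, j <- iota 0 (size ts)] ++
  [seq (E k, exist _ (gridset n (q k) (a k N)) (measurable_gridset n (q k) (a k N)))
     | k <- iota 0 M] ++
  [seq (fun w => (K k w)%:R, mset_itv (a k N.+1)) | k <- iota 0 M].
have iz : mutual_indep P (map fst z).
  have := indep ts sorted_ts M; congr mutual_indep.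
  rewrite /z !map_cat -!map_comp; congr cat.
  rewrite map_flatten -map_comp; congr flatten.
  by apply: eq_map => i /=; rewrite -map_comp.
have := mutual_indep_pairs _ iz.
rewrite !big_cat !big_allpairs_dep !big_map /= sts => h.
transitivity (P (
  \big[setI/setT]_(i <- iota 0 N) \big[setI/setT]_(j <- iota 0 M)
      (inc i j @^-1` `]-oo, (a j i)[%classic) `&`
  (\big[setI/setT]_(k <- iota 0 M) (E k @^-1` gridset n (q k) (a k N)) `&`
  \big[setI/setT]_(k <- iota 0 M)
     ((fun w => (K k w)%:R) @^-1` `]-oo, (a k N.+1)[%classic)))).
  congr (P _); rewrite -!bigcap_seq; under eq_bigcapr do rewrite -bigcap_seq.
  have eJ w k : (k <= M)%N -> gridcell n M q w -> gridJ n k w = T k.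
    move=> kM hw; rewrite /gridJ /T; apply: eq_bigr => j _.
    by rewrite hw// (leq_trans (ltn_ord j)).
  apply/seteqP; split => w /=.
    move=> [hb hc]; split; [|split].
    - move=> i /=; rewrite mem_iota0 => iN j /=; rewrite mem_iota0 => jM.
      rewrite /= in_itv /= /inc ntsS// nts//.
      have := hb j i jM; rewrite /driver_of iN !eJ//; last exact: ltnW.
      by apply; lia.
    - move=> k /=; rewrite mem_iota0 => kM; split => /=; last exact: hc.
      rewrite in_itv /=; have := hb k N kM; rewrite /driver_of ltnn eqxx.
      by apply; lia.
    - move=> k /=; rewrite mem_iota0 => kM /=.
      rewrite in_itv /=; have := hb k N.+1 kM.
      rewrite /driver_of nSN nSE.
      by apply; lia.
  move=> [hB [hE hK]].
  have hc : gridcell n M q w.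
    by move=> k kM; have [|] := hE k _; rewrite //= mem_iota0.
  split => // k i kM; rewrite /driver_of ltnS leq_eqVlt => /orP[/eqP ->|].
    rewrite nSN nSE.
    by have := hK k; rewrite /= mem_iota0 in_itv /=; apply.
  rewrite ltnS leq_eqVlt => /orP[/eqP ->|iN].
    rewrite ltnn eqxx; have [|] := hE k _; first by rewrite /= mem_iota0.
    by rewrite /= in_itv.
  rewrite iN !eJ//; last exact: ltnW.
  have := hB i; rewrite /= mem_iota0 => /(_ iN k).
  by rewrite /= mem_iota0 => /(_ kM); rewrite /= in_itv /= /inc ntsS// nts.
have io m : iota 0 m = index_iota 0 m by rewrite /index_iota subn0.
(* The factors come grouped by particle; exchanging the products groups them by row. *)
rewrite h {h} !io exchange_big /= !big_mkord -!big_split /= -prodEFin.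
apply: eq_bigr => k _.
rewrite /cellprob !EFinM; congr (_ * (_ * _))%E.
- rewrite big_mkord -prodEFin; apply: eq_bigr => i _.
  rewrite fineK ?fin_num_measure//.
  rewrite (_ : inc i k = (fun w => B i (T k.+1) w - B i (T k) w)).
    have := lawB i (ltn_ord i) (T k) (T k.+1) (T0 k) (Tlt _ _ (ltnSn k))
      _ (measurable_itv `]-oo, a k i[).
    by rewrite TS => ->.
  by apply/funext => w; rewrite /inc ntsS// nts.
- rewrite prE; last first.
    rewrite -[X in measurable X]setTI.
    by apply: measurable_drvE => //; exact: measurable_gridset.
  by rewrite !law_drvE//; exact: measurable_gridset.
- rewrite prE; last first.
    by rewrite -[X in measurable X]setTI; exact: measurable_drvKR.
  exact: K_law.
Qed.

End driver_grid.

(** * Independence of the rows *)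

Section driver_iid.
Context {R : realType} {d : measure_display} {Omega : measurableType d}.
Variable P : probability Omega R.
Local Notation pr := (pr P).
Variables (N : nat) (B : nat -> R -> Omega -> R) (E : nat -> Omega -> R).
Variable K : nat -> Omega -> nat.
Hypotheses (hN : (0 < N)%N) (Hdrv : NBBM_driver P N B E K).

Let Vn n := driver_of N B E K (gridJ E n).

Let mVn n k i : measurable_fun setT (Vn n k i).
Proof.
apply: (measurable_driver_of P N B E K) => // l j jN.
exact: (measurable_gridB P N B E K).
Qed.

Let mboxn n M a : measurable (box N.+2 M (Vn n) a).
Proof. by apply: measurable_box => k i _ _; exact: mVn. Qed.

Let mcell n M q : measurable (gridcell E n M q).
Proof. exact: (measurable_gridcell P N B E K). Qed.

Let cellE n M q a : P (box N.+2 M (Vn n) a `&` gridcell E n M q) =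
  (\prod_(k < M) cellprob P N E K n (q k) (a k))%:E.
Proof. exact: (gridcell_prob P N B E K). Qed.

Lemma sum_cellprob n b :
  (\sum_(q <oo) (cellprob P N E K n q b)%:E)%E = P (box N.+2 1 (Vn n) (fun=> b)).
Proof.
transitivity (P (\bigcup_(q in setT)
    (box N.+2 1 (Vn n) (fun=> b) `&` gridcell E n 1 (fun=> q)))).
  rewrite measure_bigcup.
  - rewrite [RHS](@eq_eseriesl _ _ predT); last by move=> q; rewrite in_setT.
    apply: eq_eseriesr => q _.
    apply/esym; apply: etrans (cellE n 1%N (fun=> q) (fun=> b)) _.
    by rewrite big_ord_recl big_ord0 mulr1.
  - by move=> q _; exact: measurableI.
  - apply/trivIsetP => q q' _ _ qq'; rewrite -subset0 => w [[_ /= h] [_ /= h']].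
    by move: qq'; rewrite -(h 0%N)// h'// eqxx.
congr (P _); rewrite -setI_bigcupr setIidl// => w _.
by exists (gridq E n 0 w) => // -[].
Qed.

Lemma grid_iid n M a :
  pr (box N.+2 M (Vn n) a) = \prod_(k < M) pr (box N.+2 1 (Vn n) (fun=> a k)).
Proof.
pose phi b := pr (box N.+2 1 (Vn n) (fun=> b)).
(* Induction on the number [m] of final rows whose cell has been summed out; the first [M - m] rows
   stay in prescribed cells. *)
suff H m : (m <= M)%N -> forall q,
    P (box N.+2 M (Vn n) a `&` gridcell E n (M - m) q) =
    (\prod_(k < M - m) cellprob P N E K n (q k) (a k) *
     \prod_(M - m <= k < M) phi (a k))%:E.
  have := H M (leqnn M) (fun=> 0%N).
  rewrite subnn big_ord0 mul1r (_ : gridcell _ _ _ _ = setT); last first.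
    by rewrite -subTset => w _ k.
  by rewrite setIT /pr => ->; rewrite big_mkord.
elim: m => [|m IH] mM q.
  by rewrite subn0 cellE big_geq// mulr1.
set l := (M - m.+1)%N.
have lM : (M - m)%N = l.+1 by rewrite /l; lia.
have lM' : (l < M)%N by rewrite /l; lia.
pose ql x k := if k == l then x else q k.
transitivity (P (\bigcup_(x in setT)
   (box N.+2 M (Vn n) a `&` gridcell E n (M - m) (ql x)))).
  congr (P _); rewrite -setI_bigcupr; congr setI.
  apply/seteqP; split => w /=.
    move=> h; exists (gridq E n l w) => // k; rewrite lM ltnS leq_eqVlt /ql.
    by case: eqP => [->//|_ /= kl]; exact: h.
  move=> [x _ h] k kl; rewrite h; last by rewrite lM ltnW.
  by rewrite /ql ltn_eqF.
rewrite measure_bigcup.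
- rewrite [LHS](@eq_eseriesl _ _ predT); last by move=> x; rewrite in_setT.
  rewrite (eq_eseriesr (g := fun x =>
    ((\prod_(k < l) cellprob P N E K n (q k) (a k) *
      \prod_(l.+1 <= k < M) phi (a k))%:E * (cellprob P N E K n x (a l))%:E)%E));
    last first.
    move=> x _; apply: etrans (IH (ltnW mM) (ql x)) _.
    rewrite lM big_ord_recr /= {2}/ql eqxx.
    rewrite (eq_bigr (fun k : 'I_l => cellprob P N E K n (q k) (a k))); last first.
      by move=> k _; rewrite /ql ltn_eqF.
    by rewrite mulrAC EFinM.
  rewrite nneseriesZl; last by move=> x _; rewrite lee_fin cellprob_ge0.
  rewrite sum_cellprob -prE// -EFinM; congr EFin.
  by rewrite [in RHS]big_ltn// -/(phi (a l)) -mulrA (mulrC (phi _)).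
- by move=> x _; exact: measurableI.
- apply/trivIsetP => x x' _ _ xx'; rewrite -subset0 => w [[_ /= h] [_ /= h']].
  move: xx'; have := h l; have := h' l; rewrite lM ltnS leqnn /ql eqxx.
  by move=> /(_ erefl) -> /(_ erefl) ->; rewrite eqxx.
Qed.

Definition permidx (l : seq nat) i : nat := if (i < N)%N then nth 0%N l i else i.

Lemma permidx_lt l i : perm_eq l (iota 0 N) -> (i < N.+2)%N ->
  (permidx l i < N.+2)%N.
Proof.
move=> pl iN; rewrite /permidx; case: ifP => // iN'.
have : nth 0%N l i \in iota 0 N.
  by rewrite -(perm_mem pl) mem_nth// (perm_size pl) size_iota.
by rewrite mem_iota0; lia.
Qed.

(** Permuting the coordinates of a box amounts to transporting its bounds by the inverse
    permutation, which is [index]. *)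
Definition permbound (l : seq nat) (b : nat -> R) i : R :=
  if (i < N)%N then b (index i l) else b i.

Lemma box_permidx (X : nat -> nat -> Omega -> R) l b : perm_eq l (iota 0 N) ->
  box N.+2 1 (fun k i => X k (permidx l i)) (fun=> b) =
  box N.+2 1 X (fun=> permbound l b).
Proof.
move=> pl.
have ul : uniq l by rewrite (perm_uniq pl) iota_uniq.
have sl : size l = N by rewrite (perm_size pl) size_iota.
have ml i : (i \in l) = (i < N)%N by rewrite (perm_mem pl) mem_iota0.
apply/seteqP; split => w h k i k1 iN.
  have := h k (if (i < N)%N then index i l else i) k1.
  rewrite /permidx /permbound; case: (ltnP i N) => iN'.
    rewrite -sl index_mem ml iN' nth_index ?ml//; apply.
    by have := ml i; rewrite iN' -index_mem sl; lia.
  by rewrite (ltnNge i N) iN' /=; exact.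
have := h k (permidx l i) k1 (permidx_lt _ _ pl iN).
rewrite /permbound /permidx; case: (ltnP i N) => iN'; last by rewrite (ltnNge i N) iN'.
by rewrite -ml mem_nth ?sl// index_uniq ?sl.
Qed.

(** Inside a cell the [N] increments share one centred normal law, of variance the length of the
    rounded period, so their product is invariant under permutation. *)
Lemma grid_exchangeable n l b : perm_eq l (iota 0 N) ->
  pr (box N.+2 1 (fun k i => Vn n k (permidx l i)) (fun=> b)) =
  pr (box N.+2 1 (Vn n) (fun=> b)).
Proof.
move=> pl.
have ul : uniq l by rewrite (perm_uniq pl) iota_uniq.
have sl : size l = N by rewrite (perm_size pl) size_iota.
rewrite box_permidx//.
congr fine; rewrite -!sum_cellprob; apply: eq_eseriesr => q _.
rewrite /cellprob {2 3}/permbound ltnn ltnNge leqnSn /=; congr (EFin (_ * _)).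
pose g i := fine (normal_prob 0 (Num.sqrt (gridpt n q : R)) `]-oo, b i[%classic).
have io m : index_iota 0 m = iota 0 m by rewrite /index_iota subn0.
transitivity (\prod_(i <- iota 0 N) g (index i l)).
  rewrite -io big_mkord; apply: eq_bigr => i _.
  by rewrite /g /permbound ltn_ord.
rewrite -(perm_big _ pl) (big_nth 0%N) sl big_mkord.
by apply: eq_bigr => i _; rewrite /g index_uniq ?sl.
Qed.

(* Clamping makes the grid times converge everywhere, also on the null event
   where some [E j] is negative. *)
Definition clampJ k w : R := \sum_(j < k) Order.max (E j w) 0.

Definition drv : nat -> nat -> Omega -> R := driver_of N B E K clampJ.

Lemma cvg_gridpt j w : gridpt n (gridq E n j w) @[n --> \oo] -->
  Order.max (E j w) 0.
Proof.
have h n : Order.max (E j w) 0 <= gridpt n (gridq E n j w) <=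
           Order.max (E j w) 0 + harmonic n.
  rewrite /gridpt /gridq /harmonic; apply/andP; split.
    rewrite ge_max divr_ge0// andbT ler_pdivlMr// mulrC.
    exact/ltW/truncnS_gt.
  rewrite ler_pdivrMr// mulrDl mulVf ?pnatr_eq0// -natr1 lerD2r [X in _ <= X]mulrC.
  have [E0|E0] := leP 0 (E j w).
    have := @truncn_itv R (n.+1%:R * E j w).
    by rewrite mulr_ge0// => /(_ erefl) /andP[].
  rewrite mulr0 (_ : Num.truncn _ = 0%N)//.
  apply/eqP; rewrite -leqn0 truncn_le_nat.
  by rewrite (@lt_trans _ _ 0)// pmulr_rlt0.
apply: (@squeeze_cvgr _ _ _ _ (fun=> Order.max (E j w) 0)
  (fun n => Order.max (E j w) 0 + harmonic n)).
- by apply: nearW => n; exact: h.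
- exact: cvg_cst.
- rewrite -[X in _ --> X]addr0; apply: cvgD; first exact: cvg_cst.
  exact: cvg_harmonic.
Qed.

Lemma cvg_gridJ k w : gridJ E n k w @[n --> \oo] --> clampJ k w.
Proof.
rewrite /gridJ /clampJ; elim: k => [|k IH].
  by under eq_fun do rewrite big_ord0; rewrite big_ord0; exact: cvg_cst.
under eq_fun do rewrite big_ord_recr /=.
by rewrite big_ord_recr /=; apply: cvgD => //; exact: cvg_gridpt.
Qed.

Lemma clampJ_ge0 k w : 0 <= clampJ k w.
Proof. by apply: sumr_ge0 => j _; rewrite le_max lexx orbT. Qed.

Lemma gridJ_ge0 n k w : 0 <= gridJ E n k w.
Proof. by apply: sumr_ge0 => j _; exact/ltW/gridpt_gt0. Qed.

(** Paths are continuous only within the half line [[0, +oo[]; the clamp keeps the limit time there,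
    and the grid times are sums of positive terms. *)
Lemma cvg_gridB k i w : (i < N)%N ->
  B i (gridJ E n k w) w @[n --> \oo] --> B i (clampJ k w) w.
Proof.
move=> iN; have [_ [cB _]] := Hdrv.
have /subspace_continuousP h := cB i iN w.
have h0 : `[0, +oo[%classic (clampJ k w) by rewrite /= in_itv /= andbT clampJ_ge0.
apply: (cvg_comp _ _ _ (h _ h0)) => A.
rewrite /within /= => hA.
have [m _ hm] := cvg_gridJ k w _ hA; exists m => // n mn.
by apply: (hm n mn); rewrite /= in_itv /= andbT gridJ_ge0.
Qed.

Lemma cvg_driver k i w : Vn n k i w @[n --> \oo] --> drv k i w.
Proof.
rewrite /Vn /drv /driver_of; case: (ltnP i N) => iN.
  by apply: cvgB; exact: cvg_gridB.
by case: eqP => _; exact: cvg_cst.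
Qed.

Lemma measurable_drv k i : measurable_fun setT (drv k i).
Proof.
apply: (measurable_fun_cvg (h := fun n => Vn n k i)) => [n|w _].
  exact: mVn.
exact: cvg_driver.
Qed.

Let row (k : nat) : set (nat * nat) := [set k] `*` `I_N.+2.

Let frow k : finite_set (row k).
Proof. by apply: finite_setX => //; exact: finite_II. Qed.

Let rowE k (X : nat -> nat -> Omega -> R) (a : nat -> nat -> R) :
  gbox (row k) (fun x => X x.1 x.2) (fun x => a x.1 x.2) =
  box N.+2 1 (fun=> X k) (fun=> a k).
Proof.
apply/seteqP; split => w h.
  by move=> j i _ iN; exact: (h (k, i)).
by move=> [j i] [/= -> iN]; exact: (h 0%N).
Qed.

Lemma drv_iid M a : pr (box N.+2 M drv a) =
  \prod_(k < M) pr (box N.+2 1 drv (fun=> a k)).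
Proof.
pose D1 (j : nat) : set (nat * nat) := `I_M `*` `I_N.+2.
have fD1 j : finite_set (D1 j) by apply: finite_setX; exact: finite_II.
have D1E (X : nat -> nat -> Omega -> R) (b : nat -> nat -> R) :
    gbox (D1 0%N) (fun x => X x.1 x.2) (fun x => b x.1 x.2) = box N.+2 M X b.
  apply/seteqP; split => w h; first by move=> k i kM iN; exact: (h (k, i)).
  by move=> [k i] [/= kM iN]; exact: h.
have eqn n (b : nat * nat -> R) :
    \prod_(j < 1) pr (gbox (D1 j) (fun x => Vn n x.1 x.2) b) =
    \prod_(j < M) pr (gbox (row j) (fun x => Vn n 0 x.2) b).
  pose b' k i := b (k, i).
  have -> : b = (fun x => b' x.1 x.2) by apply/funext => -[].
  rewrite big_ord_recl big_ord0 mulr1 D1E grid_iid; apply: eq_bigr => k _.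
  rewrite (rowE k (fun=> Vn n 0) b'); congr pr.
  by apply/seteqP; split => w h j i; case: j => // _; exact: (h 0%N).
have [lhs rhs] : pr (box N.+2 M drv a) =
      \prod_(j < 1) pr (gbox (D1 j) (fun x => drv x.1 x.2) (fun x => a x.1 x.2)) /\
    \prod_(k < M) pr (box N.+2 1 drv (fun=> a k)) =
      \prod_(j < M) pr (gbox (row j) (fun x => drv 0 x.2) (fun x => a x.1 x.2)).
  split; first by rewrite big_ord_recl big_ord0 mulr1 D1E.
  apply: eq_bigr => k _; rewrite (rowE k (fun=> drv 0) a); congr pr.
  by apply/seteqP; split => w h j i; case: j => // _; exact: (h 0%N).
(* The limit lemma yields inequalities; the grid identity being an equality, it is applied in both
   directions. *)
rewrite lhs rhs; apply/eqP; rewrite eq_le; apply/andP; split.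
  apply: (gbox_limit_le P 1 M D1 row _ _ (fun n x => Vn n x.1 x.2)
    (fun n x => Vn n 0 x.2)) => //.
  - by move=> j i _ _; exact: measurable_drv.
  - by move=> j i _ _; exact: measurable_drv.
  - by move=> j i w _ _; exact: cvg_driver.
  - by move=> j i w _ _; exact: cvg_driver.
  - by move=> n b; rewrite eqn.
apply: (gbox_limit_le P M 1 row D1 _ _ (fun n x => Vn n 0 x.2)
  (fun n x => Vn n x.1 x.2)) => //.
- by move=> j i _ _; exact: measurable_drv.
- by move=> j i _ _; exact: measurable_drv.
- by move=> j i w _ _; exact: cvg_driver.
- by move=> j i w _ _; exact: cvg_driver.
- by move=> n b; rewrite eqn.
Qed.

Lemma drv_exchangeable l b : perm_eq l (iota 0 N) ->
  pr (box N.+2 1 (fun k i => drv k (permidx l i)) (fun=> b)) =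
  pr (box N.+2 1 drv (fun=> b)).
Proof.
move=> pl.
have e (X : nat -> nat -> Omega -> R) (c : nat -> nat -> R) :
    gbox (row 0) (fun x => X x.1 x.2) (fun x => c x.1 x.2) = box N.+2 1 X c.
  rewrite (rowE 0 X c).
  by apply/seteqP; split => w h j i; case: j => // _; exact: (h 0%N).
have eqn n (c : nat * nat -> R) :
    \prod_(j < 1) pr (gbox (row j) (fun x => Vn n x.1 (permidx l x.2)) c) =
    \prod_(j < 1) pr (gbox (row j) (fun x => Vn n x.1 x.2) c).
  pose c' k i := c (k, i).
  have -> : c = (fun x => c' x.1 x.2) by apply/funext => -[].
  rewrite !big_ord_recl !big_ord0 !mulr1.
  rewrite (e (fun k i => Vn n k (permidx l i))) (e (Vn n)).
  have := grid_exchangeable n l (c' 0%N) pl.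
  have h (X : nat -> nat -> Omega -> R) : box N.+2 1 X c' = box N.+2 1 X (fun=> c' 0%N).
    by apply/seteqP; split => w h j i; case: j => // _; exact: (h 0%N).
  by rewrite !h.
have lim (X : nat -> nat -> Omega -> R) : pr (box N.+2 1 X (fun=> b)) =
    \prod_(j < 1) pr (gbox (row j) (fun x => X x.1 x.2) (fun x => b x.2)).
  by rewrite big_ord_recl big_ord0 mulr1 (e X (fun=> b)).
rewrite (lim (fun k i => drv k (permidx l i))) (lim drv).
apply/eqP; rewrite eq_le; apply/andP; split.
  apply: (gbox_limit_le P 1 1 row row _ _ (fun n x => Vn n x.1 (permidx l x.2))
    (fun n x => Vn n x.1 x.2)) => //.
  - by move=> j i _ _; exact: measurable_drv.
  - by move=> j i _ _; exact: measurable_drv.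
  - by move=> j i w _ _; exact: cvg_driver.
  - by move=> j i w _ _; exact: cvg_driver.
  - by move=> n c; rewrite eqn.
apply: (gbox_limit_le P 1 1 row row _ _ (fun n x => Vn n x.1 x.2)
  (fun n x => Vn n x.1 (permidx l x.2))) => //.
- by move=> j i _ _; exact: measurable_drv.
- by move=> j i _ _; exact: measurable_drv.
- by move=> j i w _ _; exact: cvg_driver.
- by move=> j i w _ _; exact: cvg_driver.
- by move=> n c; rewrite eqn.
Qed.

End driver_iid.

(** * Independence of the blocks *)

Section block_independence.
Context {R : realType} {d : measure_display} {Omega : measurableType d}.
Variable P : probability Omega R.
Local Notation pr := (pr P).
Variables (N : nat) (B : nat -> R -> Omega -> R) (E : nat -> Omega -> R).
Variable K : nat -> Omega -> nat.
Hypotheses (hN : (0 < N)%N) (Hdrv : NBBM_driver P N B E K).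

Lemma cyl_mono p k M (Q : set (nat -> nat -> R)) : (k <= M)%N ->
  measurable (Q : set (cyl p k)) -> measurable (Q : set (cyl p M)).
Proof.
move=> kM mQ.
have : measurable_fun setT
    (fun u : @cyl R p M => (fun j i => coord j i u) : @cyl R p k).
  apply: (@measurable_to_cyl R _ (cyl p M) p k
    (fun j i (u : cyl p M) => coord j i u)) => j i jk ip.
  by apply: measurable_coord => //; exact: leq_trans kM.
by move=> /(_ measurableT Q mQ); rewrite setTI.
Qed.

Definition vpath (w : Omega) : nat -> nat -> R := fun k i => drv N B E K k i w.

Let mdrv k i : measurable_fun setT (drv N B E K k i).
Proof. exact: (measurable_drv P N B E K). Qed.

Lemma measurable_vpath M : measurable_fun setT (vpath : Omega -> cyl N.+2 M).
Proof.
by apply: (measurable_to_cyl N.+2 M (drv N B E K)) => k i _ _; exact: mdrv.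
Qed.

Lemma measurable_vpath_preimage k Q : measurable (Q : set (cyl N.+2 k)) ->
  measurable (vpath @^-1` Q).
Proof.
by move=> mQ; have := measurable_vpath k measurableT Q mQ; rewrite setTI.
Qed.

Definition rowprob (b : nat -> R) : R := pr (box N.+2 1 (drv N B E K) (fun=> b)).

Let row k b : set Omega := [set w | forall i, (i < N.+2)%N -> drv N B E K k i w < b i].

Let mrow k b : measurable (row k b).
Proof.
rewrite (_ : row k b = box N.+2 1 (fun=> drv N B E K k) (fun=> b)).
  by apply: measurable_box => j i _ _; exact: mdrv.
by apply/seteqP; split => w h; [move=> j i _; exact: h|move=> i; exact: (h 0%N)].
Qed.

Lemma row_indep k Q b : measurable (Q : set (cyl N.+2 k)) ->
  P (vpath @^-1` Q `&` row k b) = ((rowprob b)%:E * P (vpath @^-1` Q))%E.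
Proof.
move=> mQ.
have r0 : 0 <= rowprob b by exact: pr_ge0.
have mVQ := measurable_vpath_preimage _ _ mQ.
have mg : measurable_fun setT
    (fun u : cyl N.+2 k => (\1_(Q : set (cyl N.+2 k)) u : R)%:E).
  by apply/measurable_EFinP; exact: measurable_indic.
have <- : (\int[P]_(w in row k b) (\1_(vpath @^-1` Q) w)%:E =
           P (vpath @^-1` Q `&` row k b))%E by rewrite integral_indic.
have <- : (\int[P]_w (\1_(vpath @^-1` Q) w)%:E = P (vpath @^-1` Q))%E.
  by rewrite integral_indic// setIT.
(* The conditioning event is the new row and the transferred function is the indicator of the past
   event [Q]: it is the law of the past that boxes determine. *)
apply: (@cyl_transfer _ _ _ P N.+2 k (drv N B E K) (drv N B E K) (row k b)
  (NngNum r0) (fun u => (\1_Q u)%:E)) => //.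
- move=> a; rewrite -!prE//; try by apply: measurable_box.
    rewrite -EFinM /= drv_iid// /rowprob; congr EFin.
    pose a' j := if j == k then b else a j.
    rewrite (_ : _ `&` _ = box N.+2 k.+1 (drv N B E K) a').
      rewrite drv_iid// big_ord_recr /= mulrC /a' eqxx; congr (_ * _).
      by apply: eq_bigr => j _; rewrite ltn_eqF.
    apply/seteqP; split => w /=.
      move=> [hr hb] j i; rewrite ltnS leq_eqVlt /a'.
      by case: eqP => [->|_ /= jk] ?; [exact: hr|exact: hb].
    move=> h; split=> [i iN|j i jk iN].
      by have := h k i (ltnSn k) iN; rewrite /a' eqxx.
    by have := h j i (ltnW jk) iN; rewrite /a' ltn_eqF.
  by apply: measurableI => //; exact: measurable_box.
Qed.

Let rrow k b : set Omega :=
  [set w | forall i, (i < N.+2)%N -> rerank N (vpath w) k i < b i].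

Lemma row_permidx k l b : perm_eq l (iota 0 N) ->
  [set w | forall i, (i < N.+2)%N -> drv N B E K k (permidx N l i) w < b i] =
  row k (permbound N l b).
Proof.
move=> pl.
have := box_permidx N hN (fun=> drv N B E K k) l b pl.
rewrite predeqE => h; apply/seteqP; split => w hw.
  by move=> i iN; exact: ((h w).1 (fun _ j _ => hw j) 0%N i).
by move=> i iN; exact: ((h w).2 (fun _ j _ => hw j) 0%N i).
Qed.

Lemma rowprob_permbound l b : perm_eq l (iota 0 N) ->
  rowprob (permbound N l b) = rowprob b.
Proof.
move=> pl; rewrite /rowprob -box_permidx//.
exact: (drv_exchangeable P N B E K).
Qed.

(* Conditionally on the past, the reordering is a fixed permutation of
   exchangeable coordinates. *)
Lemma rrow_indep k Q b : measurable (Q : set (cyl N.+2 k)) ->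
  P (vpath @^-1` Q `&` rrow k b) = ((rowprob b)%:E * P (vpath @^-1` Q))%E.
Proof.
move=> mQ.
pose L : set (seq nat) := [set` permutations (iota 0 N)].
pose Ql l : set (nat -> nat -> R) :=
  Q `&` (fun u => sortperm N (lchain N u k)) @^-1` [set l].
have fL : finite_set L by exact: finite_seq.
have mQl l : measurable (Ql l : set (cyl N.+2 k)).
  apply: measurableI => //; apply: measurable_sortperm.
  exact: seq_measurable_lchain.
have tQl (A : seq nat -> set Omega) : trivIset L (fun l => vpath @^-1` Ql l `&` A l).
  apply/trivIsetP => l l' _ _ ll'; rewrite -subset0 => w [[[_ /= h] _] [[_ /= h'] _]].
  by move: ll'; rewrite -h -h' eqxx.
have cov : Q = \bigcup_(l in L) Ql l.
  rewrite -setI_bigcupr setIidl// => u _.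
  exists (sortperm N (lchain N u k)) => //=.
  by rewrite /L /= mem_permutations perm_sortperm.
have -> : vpath @^-1` Q `&` rrow k b = \bigcup_(l in L)
    (vpath @^-1` Ql l `&` row k (permbound N l b)).
  rewrite [in LHS]cov preimage_bigcup setI_bigcupl; apply: eq_bigcupr => l.
  rewrite /L /= mem_permutations => pl; rewrite -row_permidx//.
  apply/seteqP; split => w [[Qw /= e] h]; split => // i iN.
    by have := h i iN; rewrite /rerank e /permidx /vpath; case: ifP.
  by have := h i iN; rewrite /rerank e /permidx /vpath; case: ifP.
rewrite [X in _ = (_ * P X)%E](_ : _ =
  \bigcup_(l in L) (vpath @^-1` Ql l `&` setT)); last first.
  by rewrite [in LHS]cov preimage_bigcup; apply: eq_bigcupr => l _; rewrite setIT.
rewrite !measure_fin_bigcup//; last 2 first.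
- by move=> l _; rewrite setIT; exact: measurable_vpath_preimage.
- move=> l _; apply: measurableI => //; exact: measurable_vpath_preimage.
rewrite ge0_mule_fsumr//; apply: eq_fsbigr => l.
rewrite inE /L /= mem_permutations => pl.
by rewrite setIT row_indep// rowprob_permbound.
Qed.

Definition rdrv k i w : R := rerank N (vpath w) k i.

(** Induction on [m]: the rows of the block already treated are absorbed into the past event. It
    stays measurable in the first [k + m] rows because reranking a row looks only at that row and
    earlier ones. *)
Lemma block_prob k m Q a : measurable (Q : set (cyl N.+2 k)) ->
  P (vpath @^-1` Q `&` box N.+2 m (fun j => rdrv (k + j)) a) =
  ((\prod_(j < m) rowprob (a j))%:E * P (vpath @^-1` Q))%E.
Proof.
move=> mQ; elim: m => [|m IH].
  by rewrite big_ord0 mul1e (_ : box _ _ _ _ = setT) ?setIT// -subTset => w _.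
pose Q' : set (nat -> nat -> R) :=
  Q `&` box N.+2 m (fun j i u => rerank N u (k + j) i) a.
have mQ' : measurable (Q' : set (cyl N.+2 (k + m))).
  apply: measurableI; first by apply: cyl_mono mQ; exact: leq_addr.
  apply: measurable_box => j i jm iN; apply: measurable_rerank => //.
  by rewrite ltn_add2l.
rewrite (_ : _ `&` _ = vpath @^-1` Q' `&` rrow (k + m) (a m)).
  rewrite rrow_indep// big_ord_recr /= EFinM [in RHS]muleAC [in RHS]muleC.
  by rewrite -IH.
apply/seteqP; split => w /=.
  move=> [Qw h]; split; first by split => // j i jm; exact: h (ltnW jm).
  by move=> i; exact: h.
move=> [[Qw h] h']; split => // j i; rewrite ltnS leq_eqVlt.
by move=> /orP[/eqP ->|]; [exact: h'|exact: h].
Qed.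

Lemma measurable_rdrv k i : (i < N.+2)%N -> measurable_fun setT (rdrv k i).
Proof.
move=> iN.
by apply: (measurableT_comp (measurable_rerank N k.+1 k i hN (ltnSn k) iN));
   exact: measurable_vpath.
Qed.

(** Plays the part of the Markov property at step [k]. With [Q] the whole space it also says that
    ranked rows are identically distributed. *)
Lemma block_indep k m Q (g : (nat -> nat -> R) -> \bar R) :
  measurable (Q : set (cyl N.+2 k)) ->
  measurable_fun setT (g : cyl N.+2 m -> \bar R) -> (forall u, 0 <= g u)%E ->
  (\int[P]_(w in vpath @^-1` Q) g (fun j i => rdrv (k + j) i w) =
   P (vpath @^-1` Q) * \int[P]_w g (fun j i => rdrv j i w))%E.
Proof.
move=> mQ mg g0.
have mVQ := measurable_vpath_preimage _ _ mQ.
rewrite -(prE P _ mVQ).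
apply: (@cyl_transfer _ _ _ P N.+2 m (fun j => rdrv (k + j)) rdrv
  (vpath @^-1` Q) (NngNum (pr_ge0 P (vpath @^-1` Q))) g) => //.
- by move=> j i _; exact: measurable_rdrv.
- by move=> j i _; exact: measurable_rdrv.
- move=> a; rewrite block_prob// /= prE// muleC; congr (_ * _)%E.
  have := block_prob 0 m setT a measurableT.
  by rewrite preimage_setT setTI probability_setT mule1 => <-.
Qed.

End block_independence.

(** * Moments *)

Section moments.
Context {R : realType} {d : measure_display} {Omega : measurableType d}.
Variable P : probability Omega R.
Local Notation pr := (pr P).

Lemma geometric_sum_le (C r : R) m : 0 <= C -> 0 <= r -> r < 1 ->
  \sum_(n < m) C * r ^+ n <= C / (1 - r).
Proof.
move=> C0 r0 r1; rewrite -mulr_sumr ler_wpM2l// -[leRHS]mul1r.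
rewrite ler_pdivlMr ?subr_gt0// mulrC.
have := subrX1 r m; rewrite -opprB -[in RHS](opprB 1 r) mulNr => /oppr_inj <-.
by rewrite gerBl exprn_ge0.
Qed.

(** A layer-cake bound with integer levels: [X] is at most the number of integers [n] with
    [n <= X]. *)
Lemma integral_le_tail (X : Omega -> R) (C r : R) :
  measurable_fun setT X -> (forall w, 0 <= X w) ->
  0 <= C -> 0 <= r -> r < 1 ->
  (forall n, (P [set w | (n%:R <= X w)%R] <= (C * r ^+ n)%:E)%E) ->
  (\int[P]_w (X w)%:E <= (C / (1 - r))%:E)%E.
Proof.
move=> mX X0 C0 r0 r1 hP.
have mA n : measurable [set w | n%:R <= X w].
  by apply: measurable_bool_set; exact: measurable_fun_ler.
pose f n w : \bar R := (\1_[set w | n%:R <= X w] w)%:E.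
have mf n : measurable_fun setT (f n).
  by apply/measurable_EFinP; exact: measurable_indic.
have f0 n w : (0 <= f n w)%E by rewrite lee_fin.
apply: (@le_trans _ _ (\int[P]_w (\sum_(n <oo) f n w))%E).
  apply: ge0_le_integral => //.
  - by move=> w _; rewrite lee_fin.
  - exact/measurable_EFinP.
  - by apply: ge0_emeasurable_sum => // n w _ _; exact: f0.
  - move=> w _.
    apply: le_trans (nneseries_lim_ge (Num.truncn (X w)).+1 _); last by [].
    rewrite sumEFin lee_fin big_mkord (eq_bigr (fun=> 1)); last first.
      move=> n _; rewrite indicE mem_set//=.
      have /andP[+ _] := truncn_itv (X0 w); apply: le_trans.
      by rewrite ler_nat -ltnS.
    by rewrite sumr_const card_ord ltW// truncnS_gt.
rewrite integral_nneseries//.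
apply: lime_le.
  by apply: is_cvg_nneseries => n _ _; apply: integral_ge0.
apply: nearW => m; rewrite big_mkord.
apply: (@le_trans _ _ (\sum_(n < m) (C * r ^+ n)%:E)%E); last first.
  by rewrite sumEFin lee_fin geometric_sum_le.
apply: lee_sum => n _; rewrite /f integral_indic// setIT; exact: hP.
Qed.

(* For [n s <= |x|] the density is at most [2 exp(-3n/8)] times the density
   of standard deviation [2 s]. *)
Lemma normal_tail (s : R) n : 0 < s ->
  (normal_prob 0 s [set x : R | n%:R * s <= `|x|]%R <=
   (2 * expR (- (3 / 8)) ^+ n)%:E)%E.
Proof.
move=> s0.
set S := [set x : R | _].
have mS : measurable S.
  apply: (@measurable_bool_set _ (measurableTypeR R)).
  by apply: measurable_fun_ler => //; exact: measurable_normr.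
have s2 : 0 < 2 * s by rewrite mulr_gt0.
have mpdf t : measurable_fun S (fun x => (normal_pdf 0 t x)%:E : \bar R).
  by apply/measurable_EFinP; apply: measurable_funTS; exact: measurable_normal_pdf.
apply: (@le_trans _ _ (\int[lebesgue_measure]_(x in S)
    ((2 * expR (- (3 / 8)) ^+ n)%:E * (normal_pdf 0 (2 * s) x)%:E))%E).
  apply: ge0_le_integral => //.
  - by move=> x _; rewrite lee_fin normal_pdf_ge0.
  - exact: mpdf.
  - by apply: measurable_funeM; exact: mpdf.
  move=> x; rewrite /S /= => hx; rewrite -EFinM lee_fin !normal_pdfE ?gt_eqF//.
  rewrite /normal_fun !subr0.
  have -> : normal_peak s = 2 * normal_peak (2 * s).
    rewrite /normal_peak.
    have -> : (2 * s) ^+ 2 * pi *+ 2 = 2 ^+ 2 * (s ^+ 2 * pi *+ 2) :> R by ring.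
    by rewrite sqrtrM// sqrtr_sqr ger0_norm// invfM mulrA divff ?mul1r// pnatr_eq0.
  rewrite -!mulrA ler_pM2l// [leRHS]mulrCA ler_wpM2l ?normal_peak_ge0//.
  rewrite -expRM_natl -expRD ler_expR.
  have x2 : n%:R * s ^+ 2 <= x ^+ 2.
    apply: (@le_trans _ _ ((n%:R * s) ^+ 2)).
      rewrite exprMn ler_wpM2r ?exprn_ge0 ?(ltW s0)//.
      rewrite -natrX ler_nat -mulnn.
      by case: (posnP n) => [->//|n0]; rewrite leq_pmulr.
    by rewrite -[leRHS]real_normK ?num_real// ler_sqr ?nnegrE// mulr_ge0// ltW.
  have -> : - x ^+ 2 / (s ^+ 2 *+ 2) = - (x ^+ 2 / s ^+ 2) * 2^-1 :> R.
    by field; rewrite gt_eqF.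
  have -> : - x ^+ 2 / ((2 * s) ^+ 2 *+ 2) = - (x ^+ 2 / s ^+ 2) * 8^-1 :> R.
    by field; rewrite gt_eqF.
  have : n%:R <= x ^+ 2 / s ^+ 2 by rewrite ler_pdivlMr// exprn_gt0.
  by rewrite -mulr_natl; lra.
rewrite ge0_integralZl; last 4 first.
- exact: mS.
- exact: mpdf.
- by move=> x _; rewrite lee_fin normal_pdf_ge0.
- by rewrite lee_fin mulr_ge0// exprn_ge0// expR_ge0.
rewrite -[leRHS]mule1; apply: lee_pmul => //.
- by apply: integral_ge0 => x _; rewrite lee_fin normal_pdf_ge0.
- exact: (probability_le1 (normal_prob 0 (2 * s))).
Qed.

Variables (N : nat) (B : nat -> R -> Omega -> R) (E : nat -> Omega -> R).
Variable K : nat -> Omega -> nat.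
Hypotheses (hN : (0 < N)%N) (Hdrv : NBBM_driver P N B E K).

Let mE k : measurable_fun setT (E k).
Proof. exact: (measurable_drvE P N B E K). Qed.

Let mB i t : (i < N)%N -> measurable_fun setT (B i t).
Proof. exact: (measurable_drvB P N B E K). Qed.

Let lawE k A : measurable A -> P (E k @^-1` A) = exponential_prob N%:R A.
Proof. exact: (law_drvE P N B E K). Qed.

Lemma E_gt0_ae : {ae P, forall w, forall k, 0 < E k w}.
Proof.
apply/ae_foralln => k.
exists (E k @^-1` `]-oo, 0]%classic); split.
- by rewrite -[X in measurable X]setTI; exact: mE.
- transitivity (exponential_prob (N%:R : R) `]-oo, 0]%classic); first exact: lawE.
  rewrite /exponential_prob.
  rewrite -integral_itv_bndo_bndc; last first.
    apply/measurable_EFinP; apply: measurable_funTS.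
    exact: measurable_exponential_pdf.
  apply: integral0_eq => x /=; rewrite in_itv /= => x0.
  by rewrite lt0_exponential_pdf.
- by move=> w /= /negP; rewrite -leNgt in_itv.
Qed.

Lemma E_moment : (\int[P]_w `|E 0 w|%:E < +oo)%E.
Proof.
(* The factor [expR N%:R] pays for a shift of one: the tail at [n.+2] is compared with the
   complement of [[0, n.+1]], and at [n = 0, 1] the bound is at least [1]. *)
apply: (@le_lt_trans _ _ (expR N%:R / (1 - expR (- N%:R)))%:E); last by rewrite ltry.
apply: integral_le_tail; rewrite ?expR_ge0//.
- exact: measurableT_comp.
- by rewrite expR_lt1 oppr_lt0 ltr0n.
move=> n; rewrite -expRM_natl -expRD.
have le1 : (P [set w | (n%:R <= `|E 0 w|)%R] <= 1)%E.
  apply: probability_le1; apply: measurable_bool_set.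
  by apply: measurable_fun_ler => //; exact: measurableT_comp.
case: n le1 => [|[|n]] le1.
- by rewrite mul0r addr0 (le_trans le1)// lee_fin -expR0 ler_expR.
- by rewrite mul1r subrr expR0.
apply: (@le_trans _ _ (P (~` (E 0 @^-1` `[0, n.+1%:R]%classic)))).
  apply: le_measure; rewrite ?inE.
  - apply: measurable_bool_set.
    by apply: measurable_fun_ler => //; exact: measurableT_comp.
  - by apply: measurableC; rewrite -[X in measurable X]setTI; exact: mE.
  move=> w /= hn; rewrite in_itv /= => /andP[E0 En]; move: hn.
  by rewrite ger0_norm// leNgt (le_lt_trans En)// ltr_nat.
rewrite probability_setC; last by rewrite -[X in measurable X]setTI; exact: mE.
rewrite lawE// exponential_prob_itv0c// oppeB// addeA subee// add0e lee_fin ler_expR.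
rewrite -[n.+2%:R]natr1 -mulNrn; lra.
Qed.

(** Scaling by [1 + t], which exceeds the standard deviation [Num.sqrt t], makes the bound affine in
    [t]; it can then be averaged over a random period with a finite mean only. *)
Lemma B_moment i t : (i < N)%N -> 0 < t ->
  (\int[P]_w `|B i t w - B i 0 w|%:E <=
   ((1 + t) * (2 / (1 - expR (- (3 / 8)))))%:E)%E.
Proof.
move=> iN t0.
have t1 : 0 < 1 + t by rewrite addr_gt0.
have mX : measurable_fun setT (fun w => `|B i t w - B i 0 w|).
  by apply: measurableT_comp => //; apply: measurable_funB; exact: mB.
have -> : (\int[P]_w `|B i t w - B i 0 w|%:E =
    (1 + t)%:E * \int[P]_w (`|B i t w - B i 0 w| / (1 + t))%:E)%E.
  rewrite -ge0_integralZl_EFin//.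
  - by apply: eq_integral => w _; rewrite -EFinM mulrC divfK// gt_eqF.
  - by move=> w _; rewrite lee_fin divr_ge0// ltW.
  - by apply/measurable_EFinP; exact: measurable_funM.
  - exact: ltW.
rewrite EFinM; apply: lee_wpmul2l; first by rewrite lee_fin ltW.
apply: integral_le_tail; rewrite ?expR_ge0//.
- exact: measurable_funM.
- by move=> w; rewrite divr_ge0// ltW.
move=> n; have st : 0 < Num.sqrt t by rewrite sqrtr_gt0.
have mS : measurable [set x : R | n%:R * Num.sqrt t <= `|x|].
  apply: (@measurable_bool_set _ (measurableTypeR R)).
  by apply: measurable_fun_ler => //; exact: measurable_normr.
apply: le_trans (normal_tail _ n st).
have [_ [_ [_ [lawB _]]]] := Hdrv.
have := lawB i iN 0 t (lexx 0) t0 _ mS; rewrite subr0 => <-.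
apply: le_measure; rewrite ?inE.
- apply: measurable_bool_set.
  by apply: measurable_fun_ler => //; exact: measurable_funM.
- rewrite -[X in measurable X]setTI; apply: measurable_funB => //; exact: mB.
move=> w /=; rewrite ler_pdivlMr//; apply: le_trans.
rewrite ler_wpM2l// -(@ler_pXn2r _ 2)// ?nnegrE ?sqrtr_ge0 ?(ltW t1)//.
by rewrite sqr_sqrtr ?(ltW t0)//; have := sqr_ge0 t; nra.
Qed.

Lemma E_B_indep i t F a : (i < N)%N -> 0 < t -> measurable F ->
  P (E 0 @^-1` F `&` [set w | B i t w - B i 0 w < a]) =
  (P (E 0 @^-1` F) * P [set w | (B i t w - B i 0 w < a)%R])%E.
Proof.
move=> iN t0 mF.
have [_ [_ [_ [_ [_ [_ [_ [_ indep]]]]]]]] := Hdrv.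
have sts : sorted <%R [:: 0; t] by rewrite /= t0.
pose inc i j w := B i (nth 0 [:: t] j) w - B i (nth 0 [:: 0; t] j) w.
pose S j : {A : set R | measurable A} :=
  if j == i then mset_itv a else exist _ setT measurableT.
pose z : seq ((Omega -> R) * {A : set R | measurable A}) :=
  [seq (inc k j, S k) | k <- iota 0 N, j <- iota 0 (size [:: t])] ++
  [seq (E k, exist _ F mF) | k <- iota 0 1] ++
  [seq (fun w => (K k w)%:R, exist _ setT measurableT) | k <- iota 0 1].
have iz : mutual_indep P (map fst z).
  have := indep [:: t] sts 1%N; congr mutual_indep.
  rewrite /z !map_cat -!map_comp; congr cat.
  by rewrite map_flatten -map_comp; congr flatten; apply: eq_map => k /=.
have h := mutual_indep_pairs P _ iz.
have Si j : j != i -> sval (S j) = setT by rewrite /S => /negbTE ->.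
have iN' : i \in iota 0 N by rewrite mem_iota0.
have e0 : inc i 0%N @^-1` sval (S i) = [set w | B i t w - B i 0 w < a].
  by rewrite /S eqxx; apply/seteqP; split => w /=; rewrite in_itv.
rewrite !big_cat !big_allpairs_dep !big_map in h.
have lhs : \big[setI/setT]_(k <- iota 0 N)
    \big[setI/setT]_(j <- iota 0 (size [:: t])) (inc k j @^-1` sval (S k)) =
    [set w | B i t w - B i 0 w < a].
  rewrite (bigD1_seq i) ?iota_uniq//= big_seq1 e0 big1 ?setIT// => k ki.
  by rewrite big_seq1 Si// preimage_setT.
have rhs : (\prod_(k <- iota 0 N)
    \prod_(j <- iota 0 (size [:: t])) P (inc k j @^-1` sval (S k)) =
    P [set w | (B i t w - B i 0 w < a)%R])%E.
  rewrite (bigD1_seq i) ?iota_uniq//= big_seq1 e0 big1 ?mule1// => k ki.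
  by rewrite big_seq1 Si// preimage_setT probability_setT.
move: h; rewrite lhs rhs !big_seq1 /= !preimage_setT setIT setIC => ->.
by rewrite probability_setT mule1 muleC.
Qed.

End moments.

(** * First moment of a Brownian increment over one period *)

Section increment_moment.
Context {R : realType} {d : measure_display} {Omega : measurableType d}.
Variable P : probability Omega R.
Variables (N : nat) (B : nat -> R -> Omega -> R) (E : nat -> Omega -> R).
Variable K : nat -> Omega -> nat.
Hypotheses (hN : (0 < N)%N) (Hdrv : NBBM_driver P N B E K).

Let mE k : measurable_fun setT (E k).
Proof. exact: (measurable_drvE P N B E K). Qed.

Let mB i t : (i < N)%N -> measurable_fun setT (B i t).
Proof. exact: (measurable_drvB P N B E K). Qed.

Let Cb : R := 2 / (1 - expR (- (3 / 8))).

Let Cb_ge0 : 0 <= Cb.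
Proof. by rewrite divr_ge0// subr_ge0 -expR0 ler_expR oppr_le0 divr_ge0. Qed.

Let cell n q : set Omega := gridq E n 0 @^-1` [set q].

Let mcell n q : measurable (cell n q).
Proof. exact: (nat_measurable_gridq P N B E K). Qed.

Lemma cell_moment n q i : (i < N)%N ->
  (\int[P]_(w in cell n q) `|B i (gridpt n q) w - B i 0 w|%:E =
   P (cell n q) * \int[P]_w `|B i (gridpt n q) w - B i 0 w|%:E)%E.
Proof.
move=> iN.
pose X (k j : nat) w := B i (gridpt n q) w - B i 0 w.
have mX : measurable_fun setT (X 0%N 0%N) by apply: measurable_funB; exact: mB.
rewrite -(prE P _ (mcell n q)).
apply: (@cyl_transfer _ _ _ P 1 1 X X (cell n q)
  (NngNum (pr_ge0 P (cell n q))) (fun u => `|u 0%N 0%N|%:E)) => //.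
- move=> a; rewrite /= prE//.
  have e : box 1 1 X a = [set w | B i (gridpt n q) w - B i 0 w < a 0%N 0%N].
    by apply/seteqP; split => w h; [exact: h|move=> [|k] [|j]].
  rewrite e; apply: (E_B_indep P N B E K Hdrv i (gridpt n q)
    ((fun x => Num.truncn (n.+1%:R * x)) @^-1` [set q])) => //.
    exact: gridpt_gt0.
  by apply: (@nat_measurable_truncn _ _ (measurableTypeR R)); exact: measurable_funM.
- apply/measurable_EFinP; apply: measurableT_comp => //.
  exact: (@measurable_coord R 1 1 0 0).
Qed.

Lemma grid_moment n i : (i < N)%N ->
  (\int[P]_w `|driver_of N B E K (gridJ E n) 0 i w|%:E <=
   \int[P]_w ((2 + `|E 0 w|) * Cb)%:E)%E.
Proof.
move=> iN.
have tcell : trivIset setT (cell n).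
  apply/trivIsetP => q q' _ _ qq'; rewrite -subset0 => w [/= h h'].
  by move: qq'; rewrite -h -h' eqxx.
have cov : \bigcup_q cell n q = setT.
  by rewrite -subTset => w _; exists (gridq E n 0 w).
have mD : measurable_fun setT (fun w =>
    `|driver_of N B E K (gridJ E n) 0 i w|%:E : \bar R).
  apply/measurable_EFinP; apply: measurableT_comp => //.
  apply: (measurable_driver_of P N B E K) => // l j jN.
  exact: (measurable_gridB P N B E K).
have mpt : measurable_fun setT (fun w =>
    ((1 + gridpt n (gridq E n 0 w)) * Cb)%:E : \bar R).
  apply/measurable_EFinP; apply: measurable_funM => //.
  apply: measurable_funD => //.
  apply: (measurable_fun_countcase (gridq E n 0) (fun q _ => gridpt n q)) => q.
    exact: mcell.
  exact: measurable_cst.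
apply: (@le_trans _ _ (\int[P]_w ((1 + gridpt n (gridq E n 0 w)) * Cb)%:E)%E).
  rewrite -cov !ge0_integral_bigcup//; rewrite ?cov//; last first.
    move=> w _; rewrite lee_fin mulr_ge0// addr_ge0//; exact/ltW/gridpt_gt0.
  apply: lee_nneseries => [q _ _|q _].
    by apply: integral_ge0 => w _; rewrite lee_fin.
  rewrite (eq_integral (fun w => `|B i (gridpt n q) w - B i 0 w|%:E)); last first.
    move=> w; rewrite inE /cell /= => wq; congr (`|_|%:E).
    by rewrite /driver_of iN /gridJ big_ord_recl !big_ord0 addr0 wq.
  rewrite cell_moment//.
  rewrite [leRHS](eq_integral (fun=> ((1 + gridpt n q) * Cb)%:E)); last first.
    by move=> w; rewrite inE /cell /= => ->.
  rewrite integral_cst// muleC; apply: lee_wpmul2r => //.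
  by apply: (B_moment P N B E K) => //; exact: gridpt_gt0.
apply: ge0_le_integral => //.
- move=> w _; rewrite lee_fin mulr_ge0// addr_ge0//; exact/ltW/gridpt_gt0.
- apply/measurable_EFinP; apply: measurable_funM => //.
  by apply: measurable_funD => //; exact: measurableT_comp.
(* The constant [2] is the [1] of the affine bound plus the rounding error, at most [n.+1%:R^-1]. *)
move=> w _; rewrite lee_fin ler_wpM2r// -[2]natr1 -addrA [1%:R]/(1 : R) lerD2l.
rewrite /gridpt ler_pdivrMr// mulrDl mul1r -natr1.
have trE : (gridq E n 0 w)%:R <= `|E 0 w| * n.+1%:R.
  rewrite /gridq; have [E0|E0] := leP 0 (E 0 w).
    have /andP[+ _] : (Num.truncn (n.+1%:R * E 0 w))%:R <= n.+1%:R * E 0 w <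
        (Num.truncn (n.+1%:R * E 0 w)).+1%:R by apply: truncn_itv; rewrite mulr_ge0.
    by rewrite ger0_norm// mulrC.
  rewrite (_ : Num.truncn _ = 0%N) ?mulr_ge0//; apply/eqP.
  by rewrite -leqn0 truncn_le_nat (@lt_trans _ _ 0)// pmulr_rlt0.
have : (0 : R) <= n%:R by [].
by rewrite -natr1; lra.
Qed.

(** The grid bound is uniform in [n], so Fatou's lemma carries it to the limit. *)
Lemma drv_moment i : (i < N)%N ->
  (\int[P]_w `|drv N B E K 0 i w|%:E < +oo)%E.
Proof.
move=> iN.
pose f n w : \bar R := `|driver_of N B E K (gridJ E n) 0 i w|%:E.
have mf n : measurable_fun setT (f n).
  apply/measurable_EFinP; apply: measurableT_comp => //.
  apply: (measurable_driver_of P N B E K) => // l j jN.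
  exact: (measurable_gridB P N B E K).
have cf w : f n w @[n --> \oo] --> (`|drv N B E K 0 i w|%:E : \bar R).
  apply: cvg_EFin; first by apply: nearW.
  by apply: cvg_norm; exact: (cvg_driver P N B E K).
have -> : (\int[P]_w `|drv N B E K 0 i w|%:E = \int[P]_w limn_einf (f ^~ w))%E.
  apply: eq_integral => w _; rewrite is_cvg_limn_einfE.
    by apply/esym/cvg_lim => //; exact: cf.
  by apply/cvg_ex; exists (`|drv N B E K 0 i w|%:E)%E; exact: cf.
apply: (@le_lt_trans _ _ (\int[P]_w ((2 + `|E 0 w|) * Cb)%:E)%E).
  apply: (le_trans (fatou _ _ _ _)) => //; first by move=> n w _; rewrite lee_fin.
  rewrite limn_einf_lim; apply: lime_le; first exact: is_cvg_einfs.
  apply: nearW => n; apply: le_trans (grid_moment n i iN).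
  by apply: ereal_inf_lbound; exists n => //=.
rewrite (eq_integral (fun w => (2 * Cb)%:E + Cb%:E * `|E 0 w|%:E)%E); last first.
  by move=> w _; rewrite -EFinM -EFinD; congr EFin; rewrite mulrDl (mulrC Cb).
have mabs : measurable_fun setT (fun w => `|E 0 w|%:E : \bar R).
  by apply/measurable_EFinP; exact: measurableT_comp.
have C0 : (0 <= (2 * Cb)%:E :> \bar R)%E by rewrite lee_fin mulr_ge0.
rewrite ge0_integralD//; last 2 first.
- by move=> w _; rewrite mule_ge0// lee_fin.
- exact: measurable_funeM.
rewrite integral_cst//= probability_setT mule1 ge0_integralZl_EFin//.
rewrite lte_add_pinfty ?ltry// lte_mul_pinfty//.
exact: (E_moment P N B E K).
Qed.

End increment_moment.

(** * The process at its jump times *)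

Section pathwise.
Context {R : realType} {d : measure_display} {Omega : measurableType d}.
Variable P : probability Omega R.
Variables (N : nat) (B : nat -> R -> Omega -> R) (E : nat -> Omega -> R).
Variable K : nat -> Omega -> nat.
Hypotheses (hN : (0 < N)%N) (Hdrv : NBBM_driver P N B E K).

Lemma rdrv_E k w : rdrv N B E K k N w = E k w.
Proof. by rewrite /rdrv /rerank /vpath /drv /driver_of ltnn eqxx. Qed.

Lemma rdrv_K k w : Num.truncn (rdrv N B E K k N.+1 w) = K k w.
Proof.
rewrite /rdrv /rerank /vpath /drv /driver_of ltnNge leqnSn /= gtn_eqF//.
exact: natrK.
Qed.

Lemma jtimesE k w : (forall j, 0 < E j w) ->
  jtimes (fun j => E j w) k = clampJ E k w.
Proof. by move=> E0; apply: eq_bigr => j _; rewrite max_l// ltW. Qed.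

Lemma bbm_stateE k w : (forall j, 0 < E j w) ->
  bbm_state N (fun i s => B i s w) (fun j => E j w) (fun j => K j w) k =
  lchain N (vpath N B E K w) k.
Proof.
move=> E0; elim: k => [//|k IH] /=; rewrite IH; congr bbm_jump.
  apply/eq_in_map => i; rewrite mem_iota0 => iN.
  by rewrite /vpath /drv /driver_of iN !jtimesE.
rewrite /vpath /drv /driver_of ltnNge leqnSn /= gtn_eqF//.
by rewrite natrK.
Qed.

Lemma interval_index_jtimes k w : (forall j, 0 < E j w) ->
  interval_index (jtimes (fun j => E j w)) (jtimes (fun j => E j w) k) = k.
Proof.
move=> E0.
have Jlt : {homo jtimes (fun j => E j w) : i j / (i < j)%N >-> i < j}.
  apply: homo_ltn => [y x z|j]; first exact: lt_trans.
  by rewrite /jtimes big_ord_recr /= ltrDl.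
rewrite /interval_index; case: pselect => [h|]; last first.
  by move=> []; exists k.+1; exact: Jlt.
case: ex_minnP => l /asboolP kl hl.
have lk : (k < l)%N.
  rewrite ltnNge leq_eqVlt; apply/negP => /orP[/eqP e|/Jlt lt].
    by move: kl; rewrite e ltxx.
  by have := lt_trans kl lt; rewrite ltxx.
have := hl k.+1; case: asboolP => [_ /(_ erefl)|[]]; last exact: Jlt.
by case: l lk {kl hl} => // l; rewrite !ltnS /= => kl lk; apply/eqP; rewrite eqn_leq lk.
Qed.

Definition rdrvp w : nat -> nat -> R := fun k i => rdrv N B E K k i w.

Lemma X1_clampJ k w : (forall j, 0 < E j w) ->
  NBBM_X1 N B E K (clampJ E k w) w = rmin N (rdrvp w) k.
Proof.
move=> E0; rewrite /NBBM_X1 /bbm_X1 /bbm_positions -jtimesE//.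
rewrite interval_index_jtimes// bbm_stateE//.
have -> : [seq nth 0 (lchain N (vpath N B E K w) k) i +
    (B i (jtimes (fun j => E j w) k) w - B i (jtimes (fun j => E j w) k) w)
    | i <- iota 0 N] = lchain N (vpath N B E K w) k.
  under eq_map do rewrite subrr addr0.
  rewrite -[in iota 0 N](size_lchain N (vpath N B E K w) k hN).
  exact: mkseq_nth.
by rewrite /seqmin -nth0 sort_lchain.
Qed.

Lemma K_lt_ae : {ae P, forall w, forall k, (K k w < N)%N}.
Proof.
apply/ae_foralln => k; exists [set w | (N <= K k w)%N]; split.
- rewrite (_ : mkset _ = \bigcup_(j in [set j | (N <= j)%N]) [set w | K k w = j]).
    by apply: bigcup_measurable => j _; exact: (measurable_drvK P N B E K).
  apply/seteqP; split => w /=; first by exists (K k w).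
  by move=> [i /= Ni ->].
- exact: (K_tail P N B E K).
- by move=> w /= /negP; rewrite -leqNgt.
Qed.

Lemma E_run_prob j l :
  P [set w | forall k, (k < l)%N -> 0 <= E (j + k) w <= 1] =
  ((1 - expR (- N%:R)) ^+ l)%:E.
Proof.
have [_ [_ [_ [_ [mE [lawE [_ [_ indep]]]]]]]] := Hdrv.
pose S k : {A : set R | measurable A} := if (k < j)%N then
  exist _ setT measurableT else exist _ `[0, 1]%classic (measurable_itv _).
pose z : seq ((Omega -> R) * {A : set R | measurable A}) :=
  [seq (E k, S k) | k <- iota 0 (j + l)] ++
  [seq (fun w => (K k w)%:R, exist _ setT measurableT) | k <- iota 0 (j + l)].
have iz : mutual_indep P (map fst z).
  have := indep [::] erefl (j + l)%N; congr mutual_indep.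
  rewrite /z map_cat -!map_comp (_ : flatten _ = [::])//.
  by elim: (iota 0 N) => //= ? ? ->.
have h := mutual_indep_pairs P _ iz.
rewrite !big_cat !big_map /= in h.
rewrite [X in _ `&` X]big1 in h; last by move=> k _ /=; rewrite preimage_setT.
rewrite [X in (_ * X)%E]big1 in h; last first.
  by move=> k _ /=; rewrite preimage_setT probability_setT.
rewrite setIT mule1 in h.
transitivity (P (\big[setI/setT]_(k <- iota 0 (j + l)) (E k @^-1` sval (S k)))).
  congr (P _); rewrite -bigcap_seq; apply/seteqP; split => w /=.
    move=> hw k /=; rewrite mem_iota0 => kjl; rewrite /S.
    case: (ltnP k j) => //= jk; rewrite in_itv /=.
    by rewrite -(subnKC jk); apply: hw; lia.
  move=> hw k kl; have := hw (j + k)%N; rewrite /= mem_iota0 ltn_add2l => /(_ kl).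
  by rewrite /S ltnNge leq_addr /= in_itv.
rewrite h iotaD big_cat /= big1_seq ?mul1e; last first.
  move=> k /andP[_]; rewrite mem_iota0 => kj.
  by rewrite /S kj /= preimage_setT probability_setT.
rewrite add0n (eq_big_seq (fun=> (1 - expR (- N%:R) : R)%:E)); last first.
  move=> k; rewrite mem_iota => /andP[jk _].
  rewrite /S ltnNge jk /= lawE// exponential_prob_itv0c// mulr1.
  by rewrite EFinB.
by elim: l j {S z iz h} => [|l IH] j; rewrite ?big_nil// big_cons IH exprS EFinM.
Qed.

(** Infinitely many periods exceed [1] once all are positive, a weak substitute for the law of large
    numbers that already makes the jump times unbounded. *)
Lemma E_large_ae : {ae P, forall w, forall j,
  exists k, ~~ (0 <= E (j + k) w <= 1)}.
Proof.
apply/ae_foralln => j.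
have mE k : measurable_fun setT (E k) by exact: (measurable_drvE P N B E K).
pose F l := [set w | forall k, (k < l)%N -> 0 <= E (j + k) w <= 1].
have mF l : measurable (F l).
  rewrite (_ : F l = \bigcap_(k in `I_l) (E (j + k) @^-1` `[0, 1]%classic)).
    apply: bigcap_measurableType => k _.
    by rewrite -[X in measurable X]setTI; exact: mE.
  by apply/seteqP; split => w h k /h; rewrite /= in_itv.
exists (\bigcap_l F l); split.
- exact: bigcapT_measurable.
- have niF : nonincreasing_seq F.
    move=> l l' ll'; apply/subsetPset => w h k kl; apply: h.
    exact: leq_trans ll'.
  have c1 := cvg_pr_nonincreasing P F mF niF.
  have c2 : pr P (F l) @[l --> \oo] --> (0 : R).
    rewrite (_ : (fun l => pr P (F l)) = (fun l => (1 - expR (- N%:R)) ^+ l)).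
      apply: cvg_expr; rewrite ger0_norm.
        by rewrite gtrBl expR_gt0.
      by rewrite subr_ge0 -expR0 ler_expR oppr_le0.
    by apply/funext => l; rewrite /pr /F E_run_prob.
  have e := cvg_unique _ c1 c2.
  transitivity ((pr P (\bigcap_l F l))%:E); last by rewrite e.
  by apply/esym/prE; exact: bigcapT_measurable.
- move=> w /= h l _ k kl; apply/negPn/negP => hk; apply: h; exists k.
  exact: hk.
Qed.

Lemma clampJ_le k l w : (forall j, 0 < E j w) -> (k <= l)%N ->
  clampJ E k w <= clampJ E l w.
Proof.
move=> E0; have := @homo_leq _ (clampJ E ^~ w) <=%R; apply => //.
  exact: le_trans.
by move=> j; rewrite /clampJ big_ord_recr /= lerDl le_max lexx orbT.
Qed.

Lemma clampJ_unbounded w : (forall j, 0 < E j w) ->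
  (forall j, exists k, ~~ (0 <= E (j + k) w <= 1)) ->
  forall c, exists k, c <= clampJ E k w.
Proof.
move=> E0 hE.
have H n : exists k, n%:R <= clampJ E k w.
  elim: n => [|n [k IH]]; first by exists 0%N; rewrite /clampJ big_ord0.
  have [l] := hE k; rewrite negb_and -!ltNge => /orP[|hl].
    by rewrite ltNge ltW.
  exists (k + l).+1; rewrite /clampJ big_ord_recr /= -natr1 lerD//.
    by apply: le_trans IH _; apply: clampJ_le => //; exact: leq_addr.
  by rewrite le_max ltW.
move=> c; have [k hk] := H (Num.bound `|c|); exists k; apply: le_trans hk.
by apply: le_trans (ler_norm _) _; apply/ltW/archi_boundP; exact: normr_ge0.
Qed.

End pathwise.

(** * Expectations of nonnegative functions *)

Section nonneg_expectation.
Context {R : realType} {d : measure_display} {T : measurableType d}.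
Variable P : probability T R.
Implicit Types f g : T -> R.

Definition EI f : \bar R := (\int[P]_w (f w)%:E)%E.

Definition nnmf f : Prop := measurable_fun setT f /\ forall w, 0 <= f w.

Lemma EI_ge0 f : nnmf f -> (0 <= EI f)%E.
Proof. by move=> [_ f0]; apply: integral_ge0 => w _; rewrite lee_fin. Qed.

Lemma EI_D f g : nnmf f -> nnmf g -> EI (fun w => f w + g w) = (EI f + EI g)%E.
Proof.
move=> [mf f0] [mg g0]; rewrite /EI; under eq_integral do rewrite EFinD.
by rewrite ge0_integralD//;
  try by [move=> w _; rewrite lee_fin|apply/measurable_EFinP].
Qed.

Lemma EI_Z (c : R) f : 0 <= c -> nnmf f -> EI (fun w => c * f w) = (c%:E * EI f)%E.
Proof.
move=> c0 [mf f0]; rewrite /EI; under eq_integral do rewrite EFinM.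
rewrite ge0_integralZl_EFin//; first by move=> w _; rewrite lee_fin.
exact/measurable_EFinP.
Qed.

Lemma nnmf_sum (m : nat) (f : nat -> T -> R) : (forall j, nnmf (f j)) ->
  nnmf (fun w => \sum_(j < m) f j w).
Proof.
move=> hf; split; last by move=> w; apply: sumr_ge0 => j _; have [_] := hf j.
by apply: measurable_sum => j; have [] := hf j.
Qed.

Lemma nnmfD f g : nnmf f -> nnmf g -> nnmf (fun w => f w + g w).
Proof.
move=> [mf f0] [mg g0]; split; first exact: measurable_funD.
by move=> w; rewrite addr_ge0.
Qed.

Lemma nnmfM f g : nnmf f -> nnmf g -> nnmf (fun w => f w * g w).
Proof.
move=> [mf f0] [mg g0]; split; first exact: measurable_funM.
by move=> w; rewrite mulr_ge0.
Qed.

Lemma nnmf_cst (c : R) : 0 <= c -> nnmf (fun=> c).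
Proof. by move=> c0; split => //; exact: measurable_cst. Qed.

Lemma nnmf_norm f : measurable_fun setT f -> nnmf (fun w => `|f w|).
Proof. by move=> mf; split => //; exact: measurableT_comp. Qed.

Lemma nnmf_indic (A : set T) : measurable A -> nnmf (\1_A).
Proof. by move=> mA; split => //; exact: measurable_indic. Qed.

Lemma EI_indic (A : set T) : measurable A -> EI (\1_A) = P A.
Proof. by move=> mA; rewrite /EI integral_indic// setIT. Qed.

Lemma EI_cst (c : R) : EI (fun=> c) = c%:E.
Proof. by rewrite /EI integral_cst//= probability_setT mule1. Qed.

Lemma EI_sum m (f : nat -> T -> R) : (forall j, nnmf (f j)) ->
  EI (fun w => \sum_(j < m) f j w) = (\sum_(j < m) EI (f j))%E.
Proof.
move=> hf; elim: m => [|m IH].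
  rewrite big_ord0 /EI; under eq_integral do rewrite big_ord0.
  by rewrite integral0.
rewrite big_ord_recr /= -IH -EI_D//; last exact: nnmf_sum.
by congr EI; apply/funext => w; rewrite big_ord_recr.
Qed.

Lemma EI_le_ae f g : nnmf f -> nnmf g -> {ae P, forall w, f w <= g w} ->
  (EI f <= EI g)%E.
Proof.
move=> [mf f0] [mg g0] fg; apply: ae_ge0_le_integral => //.
- by move=> w _; rewrite lee_fin.
- exact/measurable_EFinP.
- by move=> w _; rewrite lee_fin.
- exact/measurable_EFinP.
- by apply: filterS fg => w h _; rewrite lee_fin.
Qed.

Lemma EI_le f g : nnmf f -> nnmf g -> (forall w, f w <= g w) -> (EI f <= EI g)%E.
Proof. by move=> hf hg h; apply: EI_le_ae => //; exact: aeW. Qed.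

(** The tail part of a variable, as in uniform integrability. *)
Definition overshoot (c : R) (x : R) : R := if c < x then x else 0.

Lemma measurable_overshoot c : measurable_fun setT (overshoot c).
Proof.
rewrite /overshoot; apply: measurable_fun_ifT => //.
exact: measurable_fun_ltr.
Qed.

Lemma nnmf_overshoot c f : nnmf f -> nnmf (fun w => overshoot c (f w)).
Proof.
move=> [mf f0]; split; first exact: measurableT_comp (measurable_overshoot c) mf.
by move=> w; rewrite /overshoot; case: ifP.
Qed.

Lemma overshoot_small f (e : R) : nnmf f -> (EI f < +oo)%E -> 0 < e ->
  exists2 c : R, 0 <= c & (EI (fun w => overshoot c (f w)) < e%:E)%E.
Proof.
move=> hf foo e0; have [mf f0] := hf.
have mo n := nnmf_overshoot n%:R f hf.
have h : (EI (fun w => overshoot n%:R (f w)) @[n --> \oo] --> 0)%E.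
  rewrite -[X in _ --> X](@integral0 _ _ _ P setT).
  apply: (@dominated_cvg _ _ _ P setT measurableT
    (fun n w => (overshoot n%:R (f w))%:E) (cst 0%E) (fun w => (f w)%:E)) => //.
  - by move=> n; apply/measurable_EFinP; exact: (mo n).1.
  - move=> w _; apply: cvg_EFin; first exact: nearW.
    rewrite /=; apply: cvg_near_cst; exists (Num.truncn (f w)).+1 => // n /= fn.
    rewrite /overshoot ltNge (_ : f w <= n%:R)//.
    by rewrite (le_trans (ltW (truncnS_gt _)))// ler_nat.
  - apply/integrableP; split; first exact/measurable_EFinP.
    by under eq_integral do rewrite /= ger0_norm//.
  - move=> n w _; rewrite /= lee_fin ger0_norm ?(mo n).2//.
    by rewrite /overshoot; case: ifP.
apply: contrapT => hn.
have {}hn n : (e%:E <= EI (fun w => overshoot n%:R (f w)))%E.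
  by rewrite leNgt; apply/negP => hlt; apply: hn; exists n%:R.
have : (e%:E <= 0 :> \bar R)%E by apply: cvge_ge h; exact: nearW.
by rewrite lee_fin leNgt e0.
Qed.

(** By monotone convergence, a strict lower bound on the mean survives a high enough truncation. The
    walk thereby gets increments bounded above without losing its positive drift. *)
Lemma truncate_gt f (x : R) : nnmf f -> (x%:E < EI f)%E ->
  exists2 c : R, 0 <= c & (x%:E < EI (fun w => Order.min (f w) c))%E.
Proof.
move=> hf xf; have [mf f0] := hf.
apply: contrapT => hn.
have {}hn n : (EI (fun w => Order.min (f w) n%:R) <= x%:E)%E.
  by rewrite leNgt; apply/negP => h; apply: hn; exists n%:R.
move: xf; rewrite ltNge => /negP; apply.
have -> : EI f = (\int[P]_w limn (fun n => (Order.min (f w) n%:R)%:E))%E.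
  apply: eq_integral => w _; apply/esym/cvg_lim => //.
  apply: cvg_EFin; first exact: nearW.
  apply: cvg_near_cst; exists (Num.truncn (f w)).+1 => // n /= fn.
  by rewrite min_l// (le_trans (ltW (truncnS_gt _)))// ler_nat.
rewrite monotone_convergence//.
- apply: lime_le; last exact: nearW.
  apply: ereal_nondecreasing_is_cvgn => m n mn.
  apply: EI_le.
  + by split; [exact: measurable_minr|move=> w; rewrite le_min f0 ler0n].
  + by split; [exact: measurable_minr|move=> w; rewrite le_min f0 ler0n].
  + by move=> w; rewrite le_min !ge_min lexx /= ler_nat mn orbT.
- by move=> n; apply/measurable_EFinP; exact: measurable_minr.
- by move=> n w _; rewrite lee_fin le_min f0 ler0n.
- by move=> w _ m n mn; rewrite lee_fin le_min !ge_min lexx /= ler_nat mn orbT.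
Qed.

(* The integral of a nonnegative function is a supremum over simple minorants,
   so no measurability of [f] is needed. *)
Lemma integral_le_ae (f g : T -> \bar R) : (forall w, 0 <= f w)%E ->
  measurable_fun setT g -> (forall w, 0 <= g w)%E ->
  {ae P, forall w, (f w <= g w)%E} ->
  (\int[P]_w f w <= \int[P]_w g w)%E.
Proof.
move=> f0 mg g0 [A [mA PA hA]].
(* Raising [g] to infinity on the exceptional null set makes the domination of [f] hold everywhere,
   so the suprema over simple minorants compare. *)
pose h w := if w \in A then +oo%E else g w.
have h0 w : (0 <= h w)%E by rewrite /h; case: ifP.
have -> : (\int[P]_w g w = \int[P]_w h w)%E.
  apply: ge0_ae_eq_integral => //.
    apply: measurable_fun_ifT => //.
    rewrite (_ : (fun w => w \in A) = (fun w => \1_A w == 1 :> R)); last first.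
      apply/funext => w; rewrite indicE.
      by case: (w \in A); rewrite ?eqxx ?(eq_sym 0) ?oner_eq0.
    by apply: measurable_fun_eqr => //; exact: measurable_indic.
  exists A; split => // w /= hw; apply: contrapT => nA; apply: hw => _.
  by rewrite /h memNset.
rewrite !ge0_integralTE//; apply: le_ereal_sup => _ [s /= sf <-]; exists s => // w.
apply: le_trans (sf w) _; rewrite /h; case: ifPn => [_|]; first exact: leey.
move=> /negP wA; apply: contrapT => fg; apply: wA; rewrite inE; exact: hA.
Qed.

End nonneg_expectation.

(** * Positive drift over a block *)

Section block_drift.
Context {R : realType} {d : measure_display} {Omega : measurableType d}.
Variable P : probability Omega R.
Variables (N : nat) (B : nat -> R -> Omega -> R) (E : nat -> Omega -> R).
Variable K : nat -> Omega -> nat.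
Hypotheses (hN : (0 < N)%N) (Hdrv : NBBM_driver P N B E K).

Local Notation W := (rdrvp N B E K).
Local Notation EI := (EI P).

Definition duration (u : nat -> nat -> R) m : R := \sum_(j < m) u j N.

Lemma duration_rdrvp k w : (forall j, 0 < E j w) ->
  duration (W w) k = clampJ E k w.
Proof.
move=> E0; apply: eq_bigr => j _; rewrite max_l ?ltW//.
exact: rdrv_E.
Qed.

Lemma measurable_rmin m :
  measurable_fun setT (fun u : @cyl R N.+2 m => rmin N u m).
Proof. exact: seq_measurable_rchain. Qed.

Lemma measurable_duration m :
  measurable_fun setT (fun u : @cyl R N.+2 m => duration u m).
Proof.
rewrite /duration (_ : (fun _ => _) = (fun u : @cyl R N.+2 m =>
    \sum_(j < m) coord j N u))//.
apply: (@measurable_sum _ _ _ setT 'I_m (index_enum _)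
  (fun (j : 'I_m) (u : @cyl R N.+2 m) => coord j N u)) => j.
by apply: measurable_coord => //; lia.
Qed.

Lemma measurable_rdrvp m : measurable_fun setT (W : Omega -> cyl N.+2 m).
Proof.
apply: (measurable_to_cyl N.+2 m (rdrv N B E K)) => k i _ iN.
exact: (measurable_rdrv P N B E K).
Qed.

Lemma rdrvp_transfer j (g : (nat -> R) -> R) :
  measurable_fun setT (fun u : @cyl R N.+2 1 => g (u 0%N)) -> (forall x, 0 <= g x) ->
  EI (fun w => g (W w j)) = EI (fun w => g (W w 0%N)).
Proof.
move=> mg g0.
have := block_indep P N B E K hN Hdrv j 1 setT (fun u => (g (u 0%N))%:E) measurableT.
rewrite preimage_setT probability_setT mul1e => h; apply: etrans _ (h _ _).
- by apply: eq_integral => w _; rewrite /rdrvp addn0.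
- exact/measurable_EFinP.
- by move=> u; rewrite lee_fin.
Qed.

Variables (v mu : R).
Hypotheses (mu0 : 0 <= mu) (muv : mu < v).

(** The period has weight [v] so that subtracting the row masses from [(v - mu) * duration] gives a
    lower bound of the gain on every path with valid ranks and nonnegative periods; off [slow]
    nothing has to be subtracted. *)
Definition rowmass (x : nat -> R) : R := \sum_(i < N) `|x i| + v * `|x N|.

Definition gain u m : R := rmin N u m - mu * duration u m.

Let v0 : 0 <= v. Proof. exact: le_trans (ltW muv). Qed.

Lemma rowmass_ge0 x : 0 <= rowmass x.
Proof. by rewrite addr_ge0 ?mulr_ge0// sumr_ge0. Qed.

Lemma gain_lb u m : (forall j, (Num.truncn (u j N.+1) < N)%N) ->
  (forall j, 0 <= u j N) ->
  (v - mu) * duration u m - \sum_(j < m) rowmass (u j) <= gain u m.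
Proof.
move=> uN u0; have := rmin_lb N u m hN uN.
rewrite /gain /duration /rowmass big_split /= -mulr_sumr => h.
have -> : \sum_(j < m) `|u j N| = \sum_(j < m) u j N.
  by apply: eq_bigr => j _; rewrite ger0_norm.
by move: h; set S := \sum_(j < m) \sum_(i < N) _; lra.
Qed.

Lemma measurable_rowmass :
  measurable_fun setT (fun u : @cyl R N.+2 1 => rowmass (u 0%N)).
Proof.
rewrite /rowmass; apply: measurable_funD.
  apply: (@measurable_sum _ _ _ setT 'I_N (index_enum _)
    (fun (j : 'I_N) (u : @cyl R N.+2 1) => `|coord 0 j u|)) => j.
  apply: measurableT_comp => //; apply: measurable_coord => //.
  by have := ltn_ord j; lia.
apply: measurable_funM => //; apply: measurableT_comp => //.
by apply: (@measurable_coord R N.+2 1 0 N) => //; lia.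
Qed.

(** At step [0] the state is constant, so the ranked row is a fixed permutation of the labelled
    one. *)
Lemma rdrv_moment i : (i < N)%N -> (EI (fun w => `|W w 0%N i|%R) < +oo)%E.
Proof.
move=> iN; rewrite /rdrvp /rdrv /rerank iN /=.
apply: (drv_moment P N B E K) => //.
rewrite -mem_iota0 -(perm_mem (perm_sortperm N (nseq N (0 : R)))) mem_nth//.
by rewrite size_sortperm.
Qed.

Let mW j i : (i < N.+2)%N -> measurable_fun setT (fun w => W w j i).
Proof. exact: (measurable_rdrv P N B E K). Qed.

Lemma nnmf_rowmass j : nnmf (fun w => rowmass (W w j)).
Proof.
split; last by move=> w; exact: rowmass_ge0.
apply: measurable_funD.
  apply: (@measurable_sum _ _ _ setT 'I_N (index_enum _)
    (fun (i : 'I_N) w => `|W w j i|)) => i.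
  apply: measurableT_comp => //; apply: mW.
  by have := ltn_ord i; lia.
by apply: measurable_funM => //; apply: measurableT_comp => //; apply: mW; lia.
Qed.

Lemma rowmass_moment : (EI (fun w => rowmass (W w 0%N)) < +oo)%E.
Proof.
have n1 i : (i < N.+2)%N -> nnmf (fun w => `|W w 0%N i|).
  by move=> iN; apply: nnmf_norm; exact: mW.
have n2 : nnmf (fun w => v * `|W w 0%N N|).
  by apply: nnmfM; [exact: nnmf_cst|apply: n1; lia].
pose f i w := if (i < N)%N then `|W w 0%N i| else 0.
have nf i : nnmf (f i).
  rewrite /f; case: (ltnP i N) => iN; last exact: nnmf_cst.
  by apply: n1; lia.
rewrite (_ : (fun w => _) = (fun w => (\sum_(i < N) f i w) + v * `|W w 0%N N|)).
  rewrite EI_D//; last exact: nnmf_sum.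
  rewrite lte_add_pinfty//.
    rewrite EI_sum//; apply: lte_sum_pinfty => i _.
    by rewrite /f ltn_ord; exact: rdrv_moment.
  rewrite EI_Z//; last by apply: n1; lia.
  rewrite lte_mul_pinfty// /rdrvp; under [X in EI X]eq_fun do rewrite rdrv_E.
  exact: (E_moment P N B E K).
apply/funext => w; congr (_ + _).
by apply: eq_bigr => i _; rewrite /f ltn_ord.
Qed.

Lemma mean_E_gt0 : (0 < EI (fun w => `|E 0 w|%R))%E.
Proof.
have mE : measurable_fun setT (E 0) by exact: (measurable_drvE P N B E K).
rewrite lt_neqAle EI_ge0 ?andbT; last exact: nnmf_norm.
apply/eqP => /esym h.
have mE' : measurable_fun setT (fun w => (E 0 w)%:E : \bar R) by exact/measurable_EFinP.
have [/(_ h) ae0 _] := ae_eq_integral_abs P measurableT mE'.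
have [A [mA PA hA]] : {ae P, forall w : Omega, False}.
  have imp w : (setT w -> (E 0 w)%:E = cst (0%E : \bar R) w) ->
      (forall k, 0 < E k w) -> False.
    by move=> /(_ Logic.I) [e] /(_ 0%N); rewrite e ltxx.
  exact: (filterS2 _ imp ae0 (E_gt0_ae P N B E K Hdrv)).
have AT : A = setT by rewrite -subTset => w _; exact: hA.
by move: PA; rewrite AT; move: (probability_setT P) => /= -> /eqP; rewrite onee_eq0.
Qed.

Definition slow m : set Omega := [set w | rmin N (W w) m < v * duration (W w) m].

Lemma measurable_slow m : measurable (slow m).
Proof.
apply: measurable_bool_set; apply: measurable_fun_ltr.
  exact: measurableT_comp (measurable_rmin m) (measurable_rdrvp m).
apply: measurable_funM => //.
exact: measurableT_comp (measurable_duration m) (measurable_rdrvp m).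
Qed.

Definition good w : Prop := [/\ forall j, 0 < E j w, forall j, (K j w < N)%N &
  forall c, exists k, c <= clampJ E k w].

Lemma good_ae : {ae P, forall w, good w}.
Proof.
apply: filterS3 (E_gt0_ae P N B E K Hdrv) (K_lt_ae P N B E K hN Hdrv)
  (E_large_ae P N B E K hN Hdrv) => w h1 h2 h3.
by split => //; exact: clampJ_unbounded.
Qed.

Variable vN : R.
Hypotheses (vvN : v < vN).
Hypothesis HvN : {ae P, forall w, (NBBM_X1 N B E K x w / x) @[x --> +oo] --> vN}.

(** This is where the speed enters: convergence in continuous time is read along the jump times,
    which are unbounded. *)
Lemma fast_ae : {ae P, forall w, exists m0, forall m, (m0 <= m)%N -> ~ slow m w}.
Proof.
apply: filterS2 good_ae HvN => w [E0 KN Junb] cv.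
have /cvgr_gt /(_ v vvN) [c [_ hc]] := cv.
have [k hk] := Junb (Order.max c 0 + 1).
exists k => m km; rewrite /slow /= => hs.
have Jm : Order.max c 0 < clampJ E m w.
  apply: lt_le_trans (clampJ_le E k m w E0 km); apply: lt_le_trans hk.
  by rewrite ltrDl.
move: Jm; rewrite gt_max => /andP[cJ J0].
have := hc _ cJ; rewrite /= ltr_pdivlMr// X1_clampJ//.
by rewrite -duration_rdrvp// ltNge ltW.
Qed.

Lemma slow_rare (e : R) : 0 < e -> exists2 m, (0 < m)%N & pr P (slow m) < e.
Proof.
move=> e0.
pose U n := \bigcup_(k in [set k | (n <= k)%N]) slow k.
have mU n : measurable (U n).
  by apply: bigcup_measurable => k _; exact: measurable_slow.
have niU : nonincreasing_seq U.
  move=> n n' nn'; apply/subsetPset => w [k /= nk sk].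
  by exists k => //=; exact: leq_trans nk.
have c1 := cvg_pr_nonincreasing P U mU niU.
have p0 : pr P (\bigcap_n U n) = 0.
  have [A [mA PA hA]] := fast_ae.
  apply/eqP; rewrite eq_le pr_ge0 andbT.
  apply: (@le_trans _ _ (pr P A)); last by rewrite /pr [P A]PA.
  apply: le_pr => //; first exact: bigcapT_measurable.
  move=> w hw; apply: hA => -[m0 hm0].
  by have [k /= mk sk] := hw m0 Logic.I; exact: (hm0 k mk).
rewrite p0 in c1.
have /cvgr_lt /(_ e e0) [n _ hn] := c1.
(* [n.+1] instead of [n] makes the block nonempty. *)
exists n.+1 => //; apply: le_lt_trans (hn n.+1 (leqnSn n)).
by apply: le_pr => //; [exact: measurable_slow|move=> w sw; exists n.+1 => /=].
Qed.

Lemma block_drift : exists m (c : R), [/\ (0 < m)%N, 0 <= c &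
  (EI (fun w => Order.max (- gain (W w) m) 0)%R <
   EI (fun w => Order.min (Order.max (gain (W w) m) 0) c)%R)%E].
Proof.
have nE j : nnmf (fun w => `|W w j N|) by apply: nnmf_norm; apply: mW; lia.
have eoo : (EI (fun w => `|W w 0%N N|%R) < +oo)%E.
  by rewrite /rdrvp; under [X in EI X]eq_fun do rewrite rdrv_E; exact: (E_moment P N B E K).
have egt : (0 < EI (fun w => `|W w 0%N N|%R))%E.
  by rewrite /rdrvp; under [X in EI X]eq_fun do rewrite rdrv_E; exact: mean_E_gt0.
pose e := fine (EI (fun w => `|W w 0%N N|%R)).
have eE : EI (fun w => `|W w 0%N N|%R) = e%:E.
  by rewrite fineK// ge0_fin_numE// ltW.
have e0 : 0 < e by rewrite -lte_fin -eE.
have vm : 0 < v - mu by rewrite subr_gt0.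
(* A quarter of the mean drift per row. The losses on [slow m] cost two quarters per row: one for
   the tail of [rowmass] beyond [c], one for [c] times the probability of [slow m]. *)
pose de := (v - mu) * e / 4.
have de0 : 0 < de by rewrite !mulr_gt0// invr_gt0.
have [c c0 hc] := overshoot_small P _ de (nnmf_rowmass 0) rowmass_moment de0.
(* The divisor is [c + 1] because [c] may be [0]. *)
have [m m0 hm] := slow_rare (de / (c + 1)) (divr_gt0 de0 (ltr_wpDl c0 ltr01)).
have mgain : measurable_fun setT (fun w => gain (W w) m).
  apply: measurable_funB.
    exact: measurableT_comp (measurable_rmin m) (measurable_rdrvp m).
  apply: measurable_funM => //.
  exact: measurableT_comp (measurable_duration m) (measurable_rdrvp m).
pose zp w := Order.max (gain (W w) m) 0.
pose zn w := Order.max (- gain (W w) m) 0.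
have nzp : nnmf zp.
  by split; [exact: measurable_maxr|move=> w; rewrite le_max lexx orbT].
have nzn : nnmf zn.
  split; last by move=> w; rewrite le_max lexx orbT.
  by apply: measurable_maxr => //; exact: measurableT_comp.
have nq j := nnmf_rowmass j.
have nI := nnmf_indic (slow m) (measurable_slow m).
pose QB w := \sum_(j < m) (rowmass (W w j) * \1_(slow m) w : R).
have nQB : nnmf QB.
  apply: (nnmf_sum m (fun j w => rowmass (W w j) * \1_(slow m) w)) => j.
  exact: nnmfM.
pose dA w := (v - mu) * \sum_(j < m) `|W w j N|.
have ndA : nnmf dA by apply: nnmfM; [apply: nnmf_cst; exact: ltW|
  exact: (nnmf_sum m (fun j w => `|W w j N|))].
pose Q w := \sum_(j < m) rowmass (W w j).
have nQ : nnmf Q by exact: (nnmf_sum m (fun j w => rowmass (W w j))).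
have goodP w : good w -> (forall j, (Num.truncn (W w j N.+1) < N)%N) /\
    (forall j, 0 <= W w j N) /\ duration (W w) m = \sum_(j < m) `|W w j N|.
  move=> [E0 KN _]; split; first by move=> j; rewrite /rdrvp rdrv_K.
  split; first by move=> j; rewrite /rdrvp rdrv_E ltW.
  by apply: eq_bigr => j _; rewrite ger0_norm// /rdrvp rdrv_E ltW.
(* Negative terms are moved across so that both sides are nonnegative and their means add without
   integrability conditions. *)
have ineq1 : (EI (fun w => dA w + zn w)%R <= EI (fun w => zp w + QB w)%R)%E.
  apply: EI_le_ae; [exact: nnmfD|exact: nnmfD|].
  apply: filterS good_ae => w /goodP[h1 [h2 h3]].
  have hz : gain (W w) m = zp w - zn w.
    rewrite /zp /zn; move: (gain (W w) m) => g.
    by case: (ltP g 0) => h; case: (ltP (- g) 0) => h'; lra.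
  have lb := gain_lb (W w) m h1 h2.
  rewrite h3 -/(dA w) in lb.
  suff : dA w - QB w <= gain (W w) m by rewrite hz; lra.
  have [sw|/negP sw] := boolP (w \in slow m).
    rewrite /QB (eq_bigr (fun j : 'I_m => rowmass (W w j)))// => j _.
    by rewrite indicE sw mulr1.
  rewrite /QB big1 ?subr0; last first.
    by move=> j _; rewrite indicE (negbTE (introN idP sw)) mulr0.
  have : v * duration (W w) m <= rmin N (W w) m.
    by rewrite leNgt; apply/negP => h; apply: sw; rewrite inE.
  by rewrite /gain /dA -h3; lra.
have ineq2 : (EI zn <= EI Q)%E.
  apply: EI_le_ae => //; apply: filterS good_ae => w /goodP[h1 [h2 h3]].
  have lb := gain_lb (W w) m h1 h2.
  have d0 : 0 <= (v - mu) * duration (W w) m.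
    by rewrite h3 mulr_ge0 ?(ltW vm)// sumr_ge0.
  rewrite /zn ge_max nQ.2 andbT /Q; lra.
(* Finiteness of this mean is what permits cancelling it from [ineq1]. *)
have znoo : (EI zn < +oo)%E.
  apply: le_lt_trans ineq2 _.
  rewrite /Q (EI_sum P m (fun j w => rowmass (W w j)))//.
  apply: lte_sum_pinfty => j _.
  rewrite (rdrvp_transfer j rowmass measurable_rowmass rowmass_ge0).
  exact: rowmass_moment.
have dAE : EI dA = (de *+ 4 *+ m)%:E.
  rewrite /dA EI_Z//; [|exact: ltW|exact: (nnmf_sum m (fun j w => `|W w j N|))].
  rewrite (EI_sum P m (fun j w => `|W w j N|))// (eq_bigr (fun=> e%:E)); last first.
    move=> j _; rewrite -eE.
    apply: (rdrvp_transfer j (fun x => `|x N|)) => //.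
    apply: measurableT_comp => //.
    by apply: (@measurable_coord R N.+2 1 0 N) => //; lia.
  rewrite sumEFin sumr_const card_ord -EFinM mulrnAr; congr (_ *+ m)%:E.
  by rewrite -[RHS]mulr_natr /de divfK// pnatr_eq0.
have QBle : (EI QB <= (de *+ 2 *+ m)%:E)%E.
  rewrite /QB (EI_sum P m (fun j w => rowmass (W w j) * \1_(slow m) w)); last first.
    by move=> j; exact: nnmfM.
  apply: (@le_trans _ _ (\sum_(j < m) (de *+ 2)%:E)%E); last first.
    by rewrite sumEFin sumr_const card_ord.
  apply: lee_sum => j _.
  apply: (@le_trans _ _ (EI (fun w => overshoot c (rowmass (W w j)) +
      c * \1_(slow m) w))).
    apply: EI_le; first exact: nnmfM.
      by apply: nnmfD; [exact: nnmf_overshoot|apply: nnmfM => //; exact: nnmf_cst].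
    move=> w; rewrite indicE /overshoot; case: (w \in slow m) => /=.
      by rewrite !mulr1; case: ltP => h; rewrite ?add0r// lerDl.
    by rewrite !mulr0 addr0; case: ifP => // _; exact: rowmass_ge0.
  rewrite EI_D; [|exact: nnmf_overshoot|by apply: nnmfM => //; exact: nnmf_cst].
  rewrite mulr2n EFinD; apply: leeD.
    rewrite (rdrvp_transfer j (fun x => overshoot c (rowmass x))).
    - exact: ltW.
    - exact: measurableT_comp (measurable_overshoot c) measurable_rowmass.
    - by move=> x; rewrite /overshoot; case: ifP => // _; exact: rowmass_ge0.
  rewrite EI_Z// EI_indic; last exact: measurable_slow.
  rewrite -prE; last exact: measurable_slow.
  rewrite -EFinM lee_fin.
  have : pr P (slow m) * (c + 1) < de.
    by move: hm; rewrite ltr_pdivlMr// ltr_wpDl.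
  by have := pr_ge0 P (slow m); lra.
rewrite EI_D// EI_D// dAE in ineq1.
have [x znE] : exists x, EI zn = x%:E.
  by exists (fine (EI zn)); rewrite fineK// ge0_fin_numE// EI_ge0.
have lt : (x%:E < EI zp)%E.
  rewrite ltNge; apply/negP => zpx.
  have := le_trans ineq1 (leeD zpx QBle).
  rewrite znE -!EFinD lee_fin => h.
  have m1 : 0 < de *+ m by rewrite pmulrn_rgt0.
  move: h; rewrite -!mulrnA (mulnC 4) (mulnC 2) !mulrnA.
  by move: m1; set y := de *+ m; rewrite -[y *+ 4]mulr_natl -[y *+ 2]mulr_natl; lra.
have [c' c'0 hc'] := truncate_gt P zp x nzp lt.
by exists m, c'; split => //; rewrite -/zn znE.
Qed.

End block_drift.

(** * Hitting times *)

Section wald.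
Context {R : realType}.

(* Optional stopping for the walk with increments [x], which is dominated by
   [Y] and overshoots the level [r] by at most [c]. *)
Lemma stopped_sum_le (Y x : nat -> R) (A : nat -> bool) (r c : R) :
  Y 0%N = 0 -> 0 < r -> 0 <= c ->
  (forall j, Y j + x j <= Y j.+1) -> (forall j, x j <= c) ->
  (forall j, A j <-> forall l, (l <= j)%N -> Y l < r) ->
  forall n, \sum_(j < n) (if A j then x j else 0) <= r + c.
Proof.
move=> Y0 r0 c0 Yx xc hA n.
suff [] : \sum_(j < n) (if A j then x j else 0) <= r + c /\
  (A n -> \sum_(j < n) (if A j then x j else 0) <= Y n) by [].
elim: n => [|n [IH1 IH2]].
  by rewrite big_ord0 Y0 addr_ge0// ltW.
rewrite big_ord_recr /=; case: ifP => An.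
  have h := IH2 An; split.
    have /hA/(_ n (leqnn n)) := An; have := xc n; lra.
  by move=> _; apply: le_trans (Yx n); rewrite lerD2r.
rewrite addr0; split => // /hA h; move: An => /negP[]; apply/hA => l ln.
by apply: h; exact: leqW.
Qed.

End wald.

(** * The walk of block gains up to the level *)

Section hitting.
Context {R : realType} {d : measure_display} {Omega : measurableType d}.
Variable P : probability Omega R.
Variables (N : nat) (B : nat -> R -> Omega -> R) (E : nat -> Omega -> R).
Variable K : nat -> Omega -> nat.
Hypotheses (hN : (0 < N)%N) (Hdrv : NBBM_driver P N B E K).
Variables (mu r c : R) (m : nat).
Hypotheses (r0 : 0 < r) (c0 : 0 <= c) (m0 : (0 < m)%N).

Local Notation W := (rdrvp N B E K).
Local Notation EI := (EI P).
Local Notation gain := (gain N mu).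

Definition block j w : nat -> nat -> R := fun k i => rdrv N B E K (m * j + k) i w.

(** An event on labelled paths, read through [rerank], because [block_indep] conditions on the
    labelled past. *)
Definition level_past j : set (nat -> nat -> R) :=
  [set u | forall l, (l <= j)%N -> gain (rerank N u) (m * l) < r].

Definition alive j : set Omega := vpath N B E K @^-1` level_past j.

Lemma measurable_gain k : measurable_fun setT (fun u : @cyl R N.+2 k => gain u k).
Proof.
apply: measurable_funB; first exact: measurable_rmin.
by apply: measurable_funM => //; exact: measurable_duration.
Qed.

Lemma measurable_level_past j : measurable (level_past j : set (cyl N.+2 (m * j))).
Proof.
rewrite (_ : level_past j = \bigcap_(l in [set l | (l <= j)%N])
    ([set u | gain (rerank N u) (m * l) < r] : set (cyl N.+2 (m * j)))); last first.
  by apply/seteqP; split => u h l; exact: h.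
apply: bigcap_measurableType => l /= lj.
apply: (@measurable_bool_set _ (cyl N.+2 (m * j))
  (fun u => gain (rerank N u) (m * l) < r)).
apply: measurable_fun_ltr => //.
apply: (measurableT_comp (measurable_gain (m * l))
  (g := fun u : @cyl R N.+2 (m * j) => rerank N u : @cyl R N.+2 (m * l))).
apply: (@measurable_to_cyl R _ (cyl N.+2 (m * j)) N.+2 (m * l)
  (fun k i (u : cyl N.+2 (m * j)) => rerank N u k i)) => k i kl iN.
apply: measurable_rerank => //; apply: leq_trans kl _.
by rewrite leq_mul2l lj orbT.
Qed.

Lemma measurable_alive j : measurable (alive j).
Proof.
exact: (measurable_vpath_preimage P N B E K Hdrv _ _ (measurable_level_past j)).
Qed.

Lemma measurable_block j : measurable_fun setT (block j : Omega -> cyl N.+2 m).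
Proof.
apply: (measurable_to_cyl N.+2 m (fun k => rdrv N B E K (m * j + k))) => k i _ iN.
exact: (measurable_rdrv P N B E K).
Qed.

Lemma EI_block j (f : (nat -> nat -> R) -> R) :
  measurable_fun setT (f : @cyl R N.+2 m -> R) -> (forall u, 0 <= f u) ->
  EI (fun w => f (block j w) * \1_(alive j) w) =
  ((pr P (alive j))%:E * EI (fun w => f (W w)))%E.
Proof.
move=> mf f0; rewrite prE; last exact: measurable_alive.
have := block_indep P N B E K hN Hdrv (m * j) m (level_past j)
  (fun u => (f u)%:E) (measurable_level_past j).
move=> h; apply: etrans _ (h _ _).
- rewrite [RHS]integral_mkcond; apply: eq_integral => w _.
  rewrite patchE indicE /alive; case: ifP => _.
    by rewrite mulr1.
  by rewrite mulr0.
- exact/measurable_EFinP.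
- by move=> u; rewrite lee_fin.
Qed.

Lemma nnmf_block j (f : (nat -> nat -> R) -> R) :
  measurable_fun setT (f : @cyl R N.+2 m -> R) -> (forall u, 0 <= f u) ->
  nnmf (fun w => f (block j w) * \1_(alive j) w).
Proof.
move=> mf f0; apply: nnmfM.
  by split => //; exact: (measurableT_comp mf (measurable_block j)).
by apply: nnmf_indic; exact: measurable_alive.
Qed.

Definition gainp u : R := Order.min (Order.max (gain u m) 0) c.
Definition gainn u : R := Order.max (- gain u m) 0.
Definition absdur (u : nat -> nat -> R) : R := \sum_(k < m) `|u k N|.

Lemma measurable_gainp : measurable_fun setT (gainp : @cyl R N.+2 m -> R).
Proof.
apply: measurable_minr => //; apply: measurable_maxr => //.
exact: measurable_gain.
Qed.

Lemma measurable_gainn : measurable_fun setT (gainn : @cyl R N.+2 m -> R).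
Proof.
apply: measurable_maxr => //; apply: measurable_funN.
exact: measurable_gain.
Qed.

Lemma measurable_absdur : measurable_fun setT (absdur : @cyl R N.+2 m -> R).
Proof.
apply: (@measurable_sum _ _ _ setT 'I_m (index_enum _)
  (fun (j : 'I_m) (u : @cyl R N.+2 m) => `|coord j N u|)) => j.
by apply: measurableT_comp => //; apply: measurable_coord => //; lia.
Qed.

Lemma gainp_ge0 u : 0 <= gainp u.
Proof. by rewrite le_min le_max lexx orbT. Qed.

Lemma gainn_ge0 u : 0 <= gainn u.
Proof. by rewrite le_max lexx orbT. Qed.

Lemma absdur_ge0 u : 0 <= absdur u.
Proof. by rewrite sumr_ge0. Qed.

Lemma gain_block j w : (forall k, (K k w < N)%N) ->
  gain (W w) (m * j) + gain (block j w) m <= gain (W w) (m * j.+1).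
Proof.
move=> KN; rewrite mulnS addnC /gain.
have uN k : (Num.truncn (W w k N.+1) < N)%N by rewrite /rdrvp rdrv_K.
have h : rmin N (W w) (m * j) + rmin N (block j w) m <= rmin N (W w) (m * j + m).
  exact: rmin_add.
have -> : duration N (W w) (m * j + m) =
    duration N (W w) (m * j) + duration N (block j w) m.
  by rewrite /duration big_split_ord.
by move: h; lra.
Qed.

(** Optional stopping at a finite horizon, with the negative parts moved to the right so that only
    nonnegative functions are integrated. *)
Lemma alive_sum_le n :
  (EI (fun w => \sum_(j < n) (gainp (block j w) * \1_(alive j) w))%R <=
   EI (fun w => (r + c) + \sum_(j < n) (gainn (block j w) * \1_(alive j) w))%R)%E.
Proof.
apply: EI_le_ae.
- apply: (nnmf_sum n (fun j w => gainp (block j w) * \1_(alive j) w)) => j.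
  by apply: nnmf_block; [exact: measurable_gainp|exact: gainp_ge0].
- apply: nnmfD; first by apply: nnmf_cst; rewrite addr_ge0// ltW.
  apply: (nnmf_sum n (fun j w => gainn (block j w) * \1_(alive j) w)) => j.
  by apply: nnmf_block; [exact: measurable_gainn|exact: gainn_ge0].
apply: filterS (K_lt_ae P N B E K hN Hdrv) => w KN.
rewrite -lerBlDr -sumrB.
rewrite (eq_bigr (fun j : 'I_n => if w \in alive j then
    gainp (block j w) - gainn (block j w) else 0)); last first.
  by move=> j _; rewrite indicE; case: (w \in _); rewrite ?mulr1// !mulr0 subrr.
apply: (@stopped_sum_le _ (fun l => gain (W w) (m * l))
  (fun j => gainp (block j w) - gainn (block j w)) (fun j => w \in alive j)) => //.
- rewrite muln0 /gain /rmin /duration /= big_ord0 mulr0 subr0.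
  by case: (N).
- move=> j; apply: le_trans (gain_block j w KN); rewrite lerD2l.
  rewrite /gainp /gainn; move: (gain _ _) => g.
  have : Order.min (Order.max g 0) c <= Order.max g 0 by rewrite ge_min lexx.
  have : Order.max g 0 - Order.max (- g) 0 = g; last by lra.
  by case: (ltP g 0) => h; case: (ltP (- g) 0) => h'; lra.
- move=> j; have := gainn_ge0 (block j w).
  have : gainp (block j w) <= c by rewrite ge_min lexx orbT.
  lra.
- by move=> j; rewrite inE.
Qed.

(** Wald's argument: a block is independent of the event that it starts below the level, so each
    term of the stopped sum has mean [pr P (alive j)] times [a - b]. The sum counts the expected
    number of blocks, uniformly in the horizon [n]. *)
Lemma alive_total (a b : R) : b < a ->
  EI (fun w => gainp (W w)) = a%:E -> EI (fun w => gainn (W w)) = b%:E ->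
  forall n, \sum_(j < n) pr P (alive j) <= (r + c) / (a - b).
Proof.
move=> ba Ea Eb n; have := alive_sum_le n.
have rc : 0 <= r + c by rewrite addr_ge0// ltW.
rewrite EI_D; last 2 first.
- exact: nnmf_cst.
- apply: (nnmf_sum n (fun j w => gainn (block j w) * \1_(alive j) w)) => j.
  by apply: nnmf_block; [exact: measurable_gainn|exact: gainn_ge0].
rewrite (EI_sum P n (fun j w => gainp (block j w) * \1_(alive j) w)); last first.
  by move=> j; apply: nnmf_block; [exact: measurable_gainp|exact: gainp_ge0].
rewrite (EI_sum P n (fun j w => gainn (block j w) * \1_(alive j) w)); last first.
  by move=> j; apply: nnmf_block; [exact: measurable_gainn|exact: gainn_ge0].
rewrite (eq_bigr (fun j : 'I_n => (pr P (alive j) * a)%:E)); last first.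
  by move=> j _; rewrite (EI_block _ _ measurable_gainp gainp_ge0) Ea.
rewrite [X in (_ <= _ + X)%E](eq_bigr (fun j : 'I_n => (pr P (alive j) * b)%:E)); last first.
  by move=> j _; rewrite (EI_block _ _ measurable_gainn gainn_ge0) Eb.
rewrite EI_cst !sumEFin -EFinD lee_fin -!mulr_suml => h.
by rewrite ler_pdivlMr ?subr_gt0//; lra.
Qed.

Lemma absdur_block_sum n w : (forall j, 0 < E j w) ->
  \sum_(j < n) absdur (block j w) = clampJ E (m * n) w.
Proof.
move=> E0; elim: n => [|n IH]; first by rewrite muln0 /clampJ !big_ord0.
rewrite big_ord_recr /= IH mulnS addnC /clampJ big_split_ord /=; congr (_ + _).
apply: eq_bigr => k _; rewrite /block rdrv_E max_l ?(ltW (E0 _))//.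
by rewrite gtr0_norm.
Qed.

(** All blocks up to the first passage at a block end are alive, and their durations add up to the
    time of that passage. If no block end passes the level, every block is alive and the series
    diverges with the jump times, so finiteness of the hitting time need not be known beforehand. *)
Lemma hitting_time_le w : good N E K w ->
  (hitting_time (NBBM_X1 N B E K) mu r w <=
   \sum_(j <oo) (absdur (block j w) * \1_(alive j) w)%:E)%E.
Proof.
move=> [E0 KN Junb].
have s0 n : (0 <= (absdur (block n w) * \1_(alive n) w)%:E :> \bar R)%E.
  by rewrite lee_fin mulr_ge0// absdur_ge0.
have partial n : (forall l, (l < n)%N -> gain (W w) (m * l) < r) ->
    ((clampJ E (m * n) w)%:E <=
     \sum_(j <oo) (absdur (block j w) * \1_(alive j) w)%:E)%E.
  move=> hn; apply: le_trans (nneseries_lim_ge n _); last by [].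
  rewrite big_mkord sumEFin lee_fin -absdur_block_sum//.
  apply: ler_sum => j _; rewrite indicE mem_set ?mulr1// => l lj.
  by apply: hn; exact: leq_ltn_trans lj _.
have [[n0 hn0]|never] := pselect (exists n, r <= gain (W w) (m * n)).
  have [n hn hmin] := ex_minnP (ex_intro (fun n => r <= gain (W w) (m * n)) n0 hn0).
  have n_gt0 : (0 < n)%N.
    rewrite lt0n; apply/eqP => n0'; move: hn; rewrite n0' muln0 leNgt => /negP; apply.
    rewrite /gain /rmin /duration /= big_ord0 mulr0 subr0.
    by case: (N).
  apply: le_trans (partial n _); last first.
    by move=> l ln; rewrite ltNge; apply/negP => /hmin; rewrite leqNgt ln.
  (* The infimum ranges over positive times: this one is at least the first period, as [m * n] is
     positive. *)
  apply: ereal_inf_lbound; exists (clampJ E (m * n) w) => //=; split.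
    apply: lt_le_trans (clampJ_le E 1 (m * n) w E0 _).
      by rewrite /clampJ big_ord_recl big_ord0 addr0 max_l// ltW.
    by rewrite muln_gt0 m0.
  by rewrite X1_clampJ// -(duration_rdrvp N B E K).
rewrite (_ : (\sum_(j <oo) _)%E = +oo%E) ?leey//; apply/eqyP => A A0.
have [k hk] := Junb A.
apply: le_trans (partial k _).
  rewrite lee_fin; apply: le_trans hk _; apply: clampJ_le => //.
  by rewrite leq_pmull.
by move=> l _; rewrite ltNge; apply/negP => h; apply: never; exists l.
Qed.

Lemma mean_hitting_time_le (a b D : R) : b < a ->
  EI (fun w => gainp (W w)) = a%:E -> EI (fun w => gainn (W w)) = b%:E ->
  EI (fun w => absdur (W w)) = D%:E ->
  (\int[P]_w hitting_time (NBBM_X1 N B E K) mu r w <=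
   (D * ((r + c) / (a - b)))%:E)%E.
Proof.
move=> ba Ea Eb ED.
have D0 : 0 <= D.
  rewrite -lee_fin -ED; apply: EI_ge0; split; last by move=> w; exact: absdur_ge0.
  exact: (measurableT_comp measurable_absdur (measurable_rdrvp P N B E K hN Hdrv m)).
pose f j w : \bar R := (absdur (block j w) * \1_(alive j) w)%:E.
have nf j : nnmf (fun w => absdur (block j w) * \1_(alive j) w).
  by apply: nnmf_block; [exact: measurable_absdur|exact: absdur_ge0].
have mf j : measurable_fun setT (f j) by apply/measurable_EFinP; exact: (nf j).1.
have f0 j w : (0 <= f j w)%E by rewrite lee_fin; exact: (nf j).2.
apply: (@le_trans _ _ (\int[P]_w (\sum_(j <oo) f j w))%E).
  apply: integral_le_ae.
  - move=> w; apply: le_ereal_inf_tmp => _ [t [t0 _] <-].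
    by rewrite lee_fin ltW.
  - by apply: ge0_emeasurable_sum => // j w _ _; exact: f0.
  - by move=> w; apply: nneseries_ge0 => j _ _; exact: f0.
  - by apply: filterS (good_ae P N B E K hN Hdrv) => w; exact: hitting_time_le.
rewrite integral_nneseries//; apply: lime_le.
  by apply: is_cvg_nneseries => j _ _; apply: integral_ge0 => w _; exact: f0.
apply: nearW => n; rewrite big_mkord.
rewrite (eq_bigr (fun j : 'I_n => (pr P (alive j) * D)%:E)); last first.
  by move=> j _; rewrite EFinM -ED -(EI_block _ _ measurable_absdur absdur_ge0).
rewrite sumEFin lee_fin -mulr_suml mulrC ler_wpM2l//.
exact: alive_total.
Qed.

End hitting.

(** * Affine bound on the mean hitting time *)

Theorem mainTheorem1 (R : realType) (d : measure_display)
    (Omega : measurableType d) (P : probability Omega R)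
    (N : nat) (hN : (2 <= N)%N)
    (B : nat -> R -> Omega -> R) (E : nat -> Omega -> R)
    (K : nat -> Omega -> nat)
    (Hdrv : NBBM_driver P N B E K)
    (vN : R)
    (HvN : {ae P, forall w,
             (NBBM_X1 N B E K x w / x) @[x --> +oo] --> vN})
    (mu : R) (hmu0 : 0 <= mu) (hmuv : mu < vN) :
  exists alpha beta : R, forall r : R, 0 < r ->
    (\int[P]_w hitting_time (NBBM_X1 N B E K) mu r w < (alpha + beta * r)%:E)%E.
Proof.
have N0 : (0 < N)%N by exact: ltnW.
(* An intermediate speed: the gap below [vN] makes slow blocks rare, and the gap above [mu] is the
   drift of the others. *)
pose v := (mu + vN) / 2.
have muv : mu < v by rewrite /v ltr_pdivlMr//; lra.
have vvN : v < vN by rewrite /v ltr_pdivrMr//; lra.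
have [m [c [m0 c0 ba]]] :=
  block_drift P N B E K N0 Hdrv v mu hmu0 muv vN vvN HvN.
pose W := rdrvp N B E K.
have mW := measurable_rdrvp P N B E K N0 Hdrv m.
have ngp : nnmf (fun w => gainp N mu c m (W w)).
  split; last by move=> w; exact: gainp_ge0.
  exact: (measurableT_comp (measurable_gainp N N0 mu c m) mW).
have ngn : nnmf (fun w => gainn N mu m (W w)).
  split; last by move=> w; exact: gainn_ge0.
  exact: (measurableT_comp (measurable_gainn N N0 mu m) mW).
have nad : nnmf (fun w => absdur N m (W w)).
  split; last by move=> w; exact: absdur_ge0.
  exact: (measurableT_comp (measurable_absdur N m) mW).
have gpoo : (EI P (fun w => gainp N mu c m (W w)) < +oo)%E.
  apply: (@le_lt_trans _ _ (EI P (fun=> c))).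
    apply: EI_le; [exact: ngp|exact: nnmf_cst|].
    by move=> w; rewrite ge_min lexx orbT.
  by rewrite EI_cst ltry.
have adoo : (EI P (fun w => absdur N m (W w)) < +oo)%E.
  rewrite /absdur (EI_sum P m (fun j w => `|W w j N|)).
    apply: lte_sum_pinfty => j _.
    rewrite (rdrvp_transfer P N B E K N0 Hdrv j (fun x => `|x N|))//; last first.
      apply: measurableT_comp => //.
      by apply: (@measurable_coord R N.+2 1 0 N) => //; lia.
    rewrite /rdrvp; under [X in EI P X]eq_fun do rewrite rdrv_E.
    exact: (E_moment P N B E K).
  move=> j; apply: nnmf_norm; apply: (measurable_rdrv P N B E K) => //; lia.
have fineE (f : Omega -> R) : nnmf f -> (EI P f < +oo)%E ->
    EI P f = (fine (EI P f))%:E.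
  by move=> nf foo; rewrite fineK// ge0_fin_numE// EI_ge0.
have Ea := fineE _ ngp gpoo.
have Eb := fineE _ ngn (lt_trans ba gpoo).
have ED := fineE _ nad adoo.
move: Ea Eb ED ba; rewrite /gainp /gainn.
set a := fine _; set b := fine _; set D := fine _ => Ea Eb ED.
rewrite -/W Ea Eb lte_fin => ba.
(* The added [1] makes the inequality strict. *)
exists (D * (c / (a - b)) + 1), (D / (a - b)) => r r0.
apply: le_lt_trans (mean_hitting_time_le P N B E K N0 Hdrv mu r c m r0 c0 m0
  a b D ba Ea Eb ED) _.
rewrite lte_fin.
have -> : D * ((r + c) / (a - b)) = D * (c / (a - b)) + D / (a - b) * r by ring.
by rewrite ltrD2r ltrDl.
Qed.
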